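(* Let $D$ be the self-adjoint operator on $\mathcal{H}$ given by $D: e^{(n)}_{ij}\mapsto d(n,i)e^{(n)}_{ij}$, where $d(n,i)=2n+1$ if $n\neq i$ and $d(n,i)=-(2n+1)$ if $n=i$. Then the Chern character of the spectral triple $(\mathcal{A}_f,\mathcal{H},D)$ is nontrivial.
   Context: Fix a real number $q\in(0,1)$. $\mathcal{A}=C(SU_q(2))$ is the $C^*$-algebra generated by $\alpha,\beta$ subject to $\alpha^*\alpha+\beta^*\beta=I$, $\alpha\alpha^*+q^2\beta\beta^*=I$, $\alpha\beta-q\beta\alpha=0$, $\alpha\beta^*-q\beta^*\alpha=0$, $\beta^*\beta=\beta\beta^*$; $\mathcal{A}_f$ is the dense $*$-subalgebra generated by $\alpha,\beta$. $\mathcal{H}$ is the GNS space of the (faithful) Haar state of $\mathcal{A}$. It has an orthonormal basis $\{e^{(n)}_{ij}: n=0,\frac12,1,\ldots;\ i,j=-n,-n+1,\ldots,n\}$ (normalized matrix entries of the irreducible representations), and $\mathcal{A}$ acts faithfully on $\mathcal{H}$ by $$\alpha e^{(n)}_{ij}=a_+(n,i,j)e^{(n+1/2)}_{i-1/2,j-1/2}+a_-(n,i,j)e^{(n-1/2)}_{i-1/2,j-1/2},\quad \beta e^{(n)}_{ij}=b_+(n,i,j)e^{(n+1/2)}_{i+1/2,j-1/2}+b_-(n,i,j)e^{(n-1/2)}_{i+1/2,j-1/2},$$ $$a_+=\Bigl(q^{2(n+i)+2(n+j)+2}\tfrac{(1-q^{2n-2j+2})(1-q^{2n-2i+2})}{(1-q^{4n+2})(1-q^{4n+4})}\Bigr)^{1/2},\quad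 a_-=\Bigl(\tfrac{(1-q^{2n+2j})(1-q^{2n+2i})}{(1-q^{4n})(1-q^{4n+2})}\Bigr)^{1/2},$$ $$b_+=-\Bigl(q^{2(n+j)}\tfrac{(1-q^{2n-2j+2})(1-q^{2n+2i+2})}{(1-q^{4n+2})(1-q^{4n+4})}\Bigr)^{1/2},\quad b_-=\Bigl(q^{2(n+i)}\tfrac{(1-q^{2n+2j})(1-q^{2n-2i})}{(1-q^{4n})(1-q^{4n+2})}\Bigr)^{1/2},$$ where terms involving basis vectors with indices out of range are zero. Odd spectral triple: $D$ is self-adjoint on $\mathcal{H}$, has compact resolvent, and $[D,a]$ is bounded for all $a\in\mathcal{A}_f$. Index pairing: let $P$ be the projection onto the $-1$ eigenspace of $\mathrm{sign}\,D$. For an invertible $\gamma$ in $\mathcal{A}$ (or in $M_k(\mathcal{A})$, with $P$ replaced by $P\otimes I_k$), $P\gamma P$ is Fredholm on the range of $P$, and the $K$-theory–$K$-homology pairing is $\langle[\gamma],[(\mathcal{A},\mathcal{H},D)]\rangle=-\mathrm{index}(P\gamma P)$, defining a homomorphism $K_1(\mathcal{A})\to\mathbb{Z}$. The Chern character of the spectral triple is nontrivial if this homomorphism is nonzero. *)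

(* Defs.v *)
From HB Require Import structures.
From mathcomp Require Import all_boot all_order all_algebra complex.
From mathcomp Require Import all_classical all_reals all_analysis.

Set Implicit Arguments.
Unset Strict Implicit.
Unset Printing Implicit Defensive.

Import Order.TTheory GRing.Theory Num.Theory numFieldNormedType.Exports.

Local Open Scope classical_set_scope.
Local Open Scope ring_scope.
Local Open Scope complex_scope.

Section Index.
Variables (C : fieldType) (U : lmodType C).
Implicit Types V W : set U.

(* dim (V / W) = m, for subspaces W of V *)
Definition quot_dim V W (m : nat) : Prop :=
  exists b : 'I_m -> U, (forall i, V (b i)) /\
    forall v, V v -> exists! c : 'rV[C]_m, W (v - \sum_i c 0 i *: b i).

(* T restricted to the T-stable subspace V is Fredholm of index m. For bounded
   T and closed V, finite codimension of the range implies that it is closed. *)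
Definition fredholm_index (T : U -> U) V (m : int) : Prop :=
  exists p r : nat,
    [/\ quot_dim [set v | V v /\ T v = 0] [set 0] p,
        quot_dim V (T @` V) r & m = p%:Z - r%:Z].

End Index.

Section Operators.
Variables (R : realType) (H : completeNormedModType R[i]).
Variable dot : {dot H for Num.conj}.

(* dot is linear in its first argument *)
Definition hilbert_norm : Prop := forall x, `|x| ^+ 2 = dot x x.

(* The family is extended by zero outside the index set rg. *)
Definition orthonormal_basis (I : eqType) (rg : pred I) (e : I -> H) : Prop :=
  [/\ forall s t, rg s -> rg t -> dot (e s) (e t) = (s == t)%:R,
      closure [set x | exists (r : seq I) (c : I -> R[i]),
        all rg r /\ x = \sum_(s <- r) c s *: e s] = setT
    & forall s, ~~ rg s -> e s = 0].

Definition bounded_op (T : H -> H) : Prop := linear T /\ continuous T.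

Definition adjoint_of (a b : H -> H) : Prop :=
  forall x y, dot (a x) y = dot x (b y).

Definition compact_op (T : H -> H) : Prop :=
  bounded_op T /\ compact (closure (T @` [set x | `|x| <= 1])).

(* The unital *-subalgebra of operators generated by G; for the generators of
   C(SU_q(2)) the unit is alpha^* alpha + beta^* beta. *)
Inductive star_algebra (G : set (H -> H)) : set (H -> H) :=
| star_gen a : G a -> star_algebra G a
| star_id : star_algebra G id
| star_add a b : star_algebra G a -> star_algebra G b ->
    star_algebra G (fun x => a x + b x)
| star_scale (c : R[i]) a : star_algebra G a ->
    star_algebra G (fun x => c *: a x)
| star_comp a b : star_algebra G a -> star_algebra G b ->
    star_algebra G (fun x => a (b x))
| star_adj a b : star_algebra G a -> adjoint_of a b -> star_algebra G b.

(* Order on R[i]: 0 < eps forces eps to be real. *)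
Definition norm_closure (A : set (H -> H)) : set (H -> H) :=
  [set a | forall eps : R[i], 0 < eps ->
     exists2 b, A b & forall x, `|a x - b x| <= eps * `|x|].

(* An unbounded operator is given by its graph: D x y means that x is in the
   domain of D and D x = y. *)
Definition unbounded_op := H -> H -> Prop.
Implicit Type D : unbounded_op.

Definition dom D : set H := [set x | exists y, D x y].

Definition adjoint_graph D : unbounded_op :=
  fun u v => forall x y, D x y -> dot y u = dot x v.

(* An adjoint of a densely defined relation is the graph of a linear map. *)
Definition self_adjoint D : Prop :=
  closure (dom D) = setT /\ forall u v, D u v <-> adjoint_graph D u v.

(* T = (D - lambda)^-1 *)
Definition compact_resolvent D : Prop :=
  exists (lambda : R[i]) (T : H -> H),
    compact_op T /\ forall x y, T y = x <-> D x (y + lambda *: x).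

(* a preserves the domain of D, and D a - a D extends to a bounded operator *)
Definition bounded_commutator D (a : H -> H) : Prop :=
  exists2 B, bounded_op B & forall x y, D x y -> D (a x) (B x + a y).

Definition odd_spectral_triple (Af : set (H -> H)) D : Prop :=
  [/\ self_adjoint D, compact_resolvent D
    & forall a, Af a -> bounded_op a /\ bounded_commutator D a].

(* For D self-adjoint with compact resolvent, the eigenvectors of D span a
   dense subspace, so that S is unique. *)
Definition sign_of D (S : H -> H) : Prop :=
  bounded_op S /\
  forall (lambda : R) x, D x (lambda%:C *: x) -> S x = (Num.sg lambda)%:C *: x.

Definition orth_projection (P : H -> H) (E : set H) : Prop :=
  forall x, E (P x) /\ forall y, E y -> dot (x - P x) y = 0.

Definition negative_projection D (P : H -> H) : Prop :=
  exists2 S, sign_of D S & orth_projection P [set x | S x = - x].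

(* A k x k matrix of operators acts on H^k = ('I_k -> H). *)
Definition opmx k := 'M[H -> H]_k.

Definition opmx1 k : opmx k :=
  \matrix_(i, j) fun x => if i == j then x else 0.

Definition opmx_mul k (g h : opmx k) : opmx k :=
  \matrix_(i, j) fun x => \sum_l g i l (h l j x).

Definition opmx_over (A : set (H -> H)) k (g : opmx k) : Prop :=
  forall i j, A (g i j).

(* The invertible elements of M_k(A) *)
Definition GL (A : set (H -> H)) k : set (opmx k) :=
  [set g | opmx_over A g /\ exists h : opmx k,
     [/\ opmx_over A h, opmx_mul g h = opmx1 k & opmx_mul h g = opmx1 k]].

(* The upper left k x k block is g, completed by the identity (k <= m). *)
Definition opmx_pad k m (g : opmx k) : opmx m :=
  \matrix_(i, j)
    match insub (val i) : option 'I_k, insub (val j) : option 'I_k with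
    | Some i', Some j' => g i' j'
    | _, _ => opmx1 m i j
    end.

(* Norm-continuous path in GL_k(A); a matrix is close to another one in
   operator norm if and only if the entries are. *)
Definition GL_homotopic (A : set (H -> H)) k (g0 g1 : opmx k) : Prop :=
  exists g : R -> opmx k,
    [/\ g 0 = g0, g 1 = g1, forall t, 0 <= t <= 1 -> GL A (g t)
      & forall t, 0 <= t <= 1 -> forall eps : R[i], 0 < eps ->
          exists2 delta : R, 0 < delta &
            forall s, 0 <= s <= 1 -> `|s - t| < delta ->
              forall i j x, `|g s i j x - g t i j x| <= eps * `|x|].

Definition K1_eq (A : set (H -> H)) (g h : {k & opmx k}) : Prop :=
  exists2 m, (tag g <= m)%N && (tag h <= m)%N &
    GL_homotopic A (opmx_pad m (tagged g)) (opmx_pad m (tagged h)).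

Definition K1_class (A : set (H -> H)) (g : {k & opmx k}) : set {k & opmx k} :=
  [set h | GL A (tagged h) /\ K1_eq A g h].

(* K_1(A), as the set of stable homotopy classes of invertible matrices *)
Definition K1 (A : set (H -> H)) : set (set {k & opmx k}) :=
  [set K1_class A g | g in [set g | GL A (tagged g)]].

(* (P (x) I_k) g (P (x) I_k) *)
Definition compression (P : H -> H) k (g : opmx k) (v : 'I_k -> H) : 'I_k -> H :=
  fun i => P (\sum_j g i j (P (v j))).

Definition proj_range (P : H -> H) k : set ('I_k -> H) :=
  [set v | forall i, P (v i) = v i].

(* The graph of the index pairing K_1(A) -> Z, evaluated at a representative of
   the class x; homotopy invariance of the index makes it single-valued. *)
Definition index_pairing (P : H -> H) (x : set {k & opmx k}) (m : int) : Prop :=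
  exists2 g, x g &
    fredholm_index (compression P (tagged g)) (@proj_range P (tag g)) (- m).

(* The homomorphism K_1(A) -> Z defined by (A, H, D) is not zero. *)
Definition chern_nontrivial (A : set (H -> H)) D : Prop :=
  exists2 P, negative_projection D P &
    exists x m, [/\ K1 A x, index_pairing P x m & m != 0].

End Operators.

Section SUq2.
Variables (R : realType) (q : R).

(* The half-integers n, i, j are represented by the integers 2n, 2i, 2j: below,
   n, i, j : int stand for twice the indices of the basis vector e^(n)_ij. *)
Definition basis_index (s : int * int * int) : bool :=
  let: (n, i, j) := s in
  [&& `|i| <= n, `|j| <= n, (2 %| n - i)%Z & (2 %| n - j)%Z].

Implicit Types n i j : int.

Definition a_plus n i j : R :=
  Num.sqrt (q ^ ((n + i) + (n + j) + 2) *
    (((1 - q ^ (n - j + 2)) * (1 - q ^ (n - i + 2))) /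
     ((1 - q ^ (2 * n + 2)) * (1 - q ^ (2 * n + 4))))).

Definition a_minus n i j : R :=
  Num.sqrt (((1 - q ^ (n + j)) * (1 - q ^ (n + i))) /
            ((1 - q ^ (2 * n)) * (1 - q ^ (2 * n + 2)))).

Definition b_plus n i j : R :=
  - Num.sqrt (q ^ (n + j) *
    (((1 - q ^ (n - j + 2)) * (1 - q ^ (n + i + 2))) /
     ((1 - q ^ (2 * n + 2)) * (1 - q ^ (2 * n + 4))))).

Definition b_minus n i j : R :=
  Num.sqrt (q ^ (n + i) *
    (((1 - q ^ (n + j)) * (1 - q ^ (n - i))) /
     ((1 - q ^ (2 * n)) * (1 - q ^ (2 * n + 2))))).

Definition dirac_eigenvalue n i : R :=
  if n == i then - (n + 1)%:~R else (n + 1)%:~R.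

Variables (H : completeNormedModType R[i]) (dot : {dot H for Num.conj}).
Variable e : int * int * int -> H.

Definition alpha_action (alpha : H -> H) : Prop :=
  forall n i j, basis_index (n, i, j) ->
    alpha (e (n, i, j)) =
      (a_plus n i j)%:C *: e (n + 1, i - 1, j - 1) +
      (a_minus n i j)%:C *: e (n - 1, i - 1, j - 1).

Definition beta_action (beta : H -> H) : Prop :=
  forall n i j, basis_index (n, i, j) ->
    beta (e (n, i, j)) =
      (b_plus n i j)%:C *: e (n + 1, i + 1, j - 1) +
      (b_minus n i j)%:C *: e (n - 1, i + 1, j - 1).

(* The diagonal operator e^(n)_ij |-> d(n,i) e^(n)_ij on its maximal domain *)
Definition dirac_op : unbounded_op H :=
  fun x y => forall n i j, basis_index (n, i, j) ->
    dot y (e (n, i, j)) = (dirac_eigenvalue n i)%:C * dot x (e (n, i, j)).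

End SUq2.

(* Main.v *)
Require Import Defs.
From HB Require Import structures.
From mathcomp Require Import all_boot all_order all_algebra complex.
From mathcomp Require Import all_classical all_reals all_analysis ring lra zify.

Set Implicit Arguments.
Unset Strict Implicit.
Unset Printing Implicit Defensive.

Import Order.TTheory GRing.Theory Num.Theory numFieldNormedType.Exports.

Local Open Scope classical_set_scope.
Local Open Scope ring_scope.

(** Every operator of the statement is built from operators that move each
    basis vector e_s to a multiple of a translate e_(s + d). Such an operator
    exists and is bounded as soon as its weights are, and its adjoint has the
    same form ([weighted_pair], through the Riesz-Fischer theorem). A bounded
    operator is determined by its values on the basis ([bounded_op_eq]), so
    that identities between operators reduce to identities between
    coefficients. Below, a' is the adjoint of a, and n, i, j are twice the
    half-integers, as in [basis_index].

    Spectral triple. The eigenvalues d of D do not vanish, so that D is the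
    inverse of the bounded self-adjoint diagonal operator T with eigenvalues
    1 / d. Hence D is self-adjoint ([inverse_self_adjoint]), and T is compact
    because only finitely many of its eigenvalues, with multiplicity, exceed a
    given positive bound ([diagonal_compact]). The entry of [D, a] from e_s to
    e_t is that of a times d(t) - d(s). For alpha and beta this factor is 1 or
    -1, unless a step that raises n leaves the edge i = n or a step that lowers
    n reaches it; the factor then has size 2n + O(1), but the coefficient of
    alpha or beta decays like a power q^(n/2), and the product stays bounded
    ([comm_aP], [comm_bM]). Boundedness of the commutator passes from the
    generators to the star-algebra ([regular_star_algebra]).

    Index. P projects onto the closed span of the edge vectors
    f_nj = e_(n,n,j). The K_1-class that is paired with D is that of the
    fundamental matrix U = ((alpha, - q beta'), (beta, alpha')). It is unitary
    by the defining relations of SU_q(2), which hold for the given operators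
    ([fundamental_GL]). Between edge vectors, alpha only keeps the term
    f_nj -> f_(n-1)(j-1) and beta only the term f_nj -> f_(n+1)(j-1), and the
    compression T of U to the edge satisfies T T' = diag(1, L) with L diagonal,
    L f_nj = (1 - q^(2n)) / (1 - q^(2n+2)) f_nj. The only kernel of L is
    spanned by f_00, and L is bounded below on the orthogonal complement. With
    W the inverse of L there and W f_00 = 0, the operator S = T' diag(1, W)
    satisfies S T = 1, and T S is the projection orthogonal to (0, f_00). So T
    is injective with range of codimension one, its index is -1, and the
    pairing takes the value 1 ([fundamental_index]). *)

(** * Inner products and bounded operators *)

Section Inner.
Context {R : realType} {H : completeNormedModType R[i]}.
Context {dot : {dot H for Num.conj}} (hdot : hilbert_norm dot).
Implicit Types (x y z : H) (c : R[i]).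
Local Notation "x %:C" := (real_complex R x).

Lemma dotDl x y z : dot (x + y) z = dot x z + dot y z.
Proof. exact: linearDl. Qed.
Lemma dotDr x y z : dot z (x + y) = dot z x + dot z y.
Proof. exact: linearDr. Qed.
Lemma dotBl x y z : dot (x - y) z = dot x z - dot y z.
Proof. exact: linearBl. Qed.
Lemma dotBr x y z : dot z (x - y) = dot z x - dot z y.
Proof. exact: linearBr. Qed.
Lemma dotNl x z : dot (- x) z = - dot x z.
Proof. exact: linearNl. Qed.
Lemma dotNr x z : dot z (- x) = - dot z x.
Proof. exact: linearNr. Qed.
Lemma dot0l z : dot 0 z = 0.
Proof. exact: linear0l. Qed.
Lemma dot0r z : dot z 0 = 0.
Proof. exact: linear0r. Qed.
Lemma dotZl c x z : dot (c *: x) z = c * dot x z.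
Proof. exact: linearZl_LR. Qed.
Lemma dotZr c x z : dot z (c *: x) = Num.conj c * dot z x.
Proof. exact: linearZr_LR. Qed.
Lemma dotC x y : dot x y = Num.conj (dot y x).
Proof. by rewrite hermC expr0 mul1r. Qed.
Lemma dot_suml (I : Type) (r : seq I) (F : I -> H) z :
  dot (\sum_(s <- r) F s) z = \sum_(s <- r) dot (F s) z.
Proof. exact: (linear_sumlz dot). Qed.

Lemma conj_realC (r : R) : Num.conj (r%:C)%C = (r%:C)%C.
Proof. by rewrite conj_Creal // complex_real. Qed.

Lemma dot_inj x y : (forall z, dot x z = dot y z) -> x = y.
Proof.
move=> h; apply/eqP; rewrite -subr_eq0 -(dnorm_eq0 dot).
by rewrite dotBl !h subrr.
Qed.

Lemma cauchy_schwarz_identity (F : fieldType) (X d d' n : F) : n != 0 ->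
  X - d' / n ^+ 2 * d - (d / n ^+ 2 * d' - d' / n ^+ 2 * (d / n ^+ 2 * n ^+ 2)) =
  X - d * d' / n ^+ 2.
Proof. by move=> n0; field. Qed.

Lemma cauchy_schwarz x y : `|dot x y| <= `|x| * `|y|.
Proof.
have [->|y0] := eqVneq y 0; first by rewrite dot0r !normr0 mulr0.
have yy0 : 0 < `|y| ^+ 2 by rewrite exprn_gt0 // normr_gt0.
rewrite -(@ler_pXn2r _ 2) ?nnegrE ?mulr_ge0 //.
rewrite exprMn -ler_pdivrMr //.
set c := dot x y / dot y y.
have := dnorm_ge0 dot (x - c *: y).
rewrite dotBl !dotBr dotZl !dotZr dotZl -!hdot -/c.
have -> : dot y x = Num.conj (dot x y) by rewrite dotC.
have yR : Num.conj `|y| = `|y| by rewrite conj_Creal ?normr_real.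
rewrite /c -hdot rmorphM /= fmorphV /= rmorphXn /= yR.
have n0 : `|y| != 0 by rewrite normr_eq0.
rewrite normCK => h; rewrite -subr_ge0; apply: le_trans h _.
rewrite le_eqVlt; apply/orP; left; apply/eqP; exact: cauchy_schwarz_identity.
Qed.

(** Bounds are real although norms live in R[i], so that they can be compared
    without side conditions. *)
Definition bounded_by (V : normedModType R[i]) (T : H -> V) (K : R) :=
  forall x, `|T x| <= K%:C * `|x|.

Lemma bounded_op_bound (T : H -> H) : bounded_op T ->
  exists2 K : R, 0 < K & bounded_by T K.
Proof.
case=> Tl Tc.
pose L : {linear H -> H} := HB.pack T (GRing.isLinear.Build _ _ _ _ T Tl).
have /linear_boundedP/pinfty_ex_gt0 [K K0 hK] :=
  (linear_bounded_continuous L).2 Tc.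
have KE : (complex.Re (K : R[i]))%:C = K :> R[i] by rewrite RRe_real // gtr0_real.
by exists (complex.Re (K : R[i])) => [|x]; rewrite ?KE //; rewrite -ltcR KE.
Qed.

Lemma bounded_op_by (T : H -> H) (K : R) :
  linear T -> bounded_by T K -> bounded_op T.
Proof.
move=> Tl hK; split=> //.
pose L : {linear H -> H} := HB.pack T (GRing.isLinear.Build _ _ _ _ T Tl).
apply: (@bounded_linear_continuous _ _ _ L).
apply/linear_boundedP; exists K%:C; split; first by rewrite complex_real.
by move=> M KM x; apply: le_trans (hK x) _; apply: ler_wpM2r => //; exact: ltW.
Qed.

Lemma norm_real_complex (r : R) : `|r%:C| = `|r|%:C.
Proof. by rewrite normc_def /= expr0n addr0 sqrtr_sqr. Qed.

Lemma pos_complexP (u : R[i]) : 0 < u -> exists2 v : R, 0 < v & u = v%:C.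
Proof.
move=> u0; have uE : u = (complex.Re u)%:C by rewrite RRe_real // gtr0_real.
by exists (complex.Re u) => //; rewrite -ltcR -uE.
Qed.

Lemma norm_complexP (V : normedModType R[i]) (v : V) : exists2 u : R, 0 <= u & `|v| = u%:C.
Proof.
have vE : `|v| = (complex.Re (`|v| : R[i]))%:C by rewrite RRe_real // normr_real.
exists (complex.Re (`|v| : R[i])); rewrite -?vE //.
by rewrite -ler0c -vE.
Qed.

Lemma rank_one_bounded y : bounded_op (fun x => dot x y *: y).
Proof.
have [v v0 vE] := norm_complexP y.
apply: (@bounded_op_by _ (v * v)) => [a x z|x].
  by rewrite dotDl dotZl scalerDl scalerA.
rewrite normrZ vE rmorphM /= mulrAC; apply: ler_wpM2r; first by rewrite ler0c.
by rewrite -vE mulrC; exact: cauchy_schwarz.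
Qed.

End Inner.

Section LinearOperators.
Context {R : realType} {H : completeNormedModType R[i]}.
Implicit Types (x y z : H) (c : R[i]) (S T : H -> H).

Lemma bounded_opD T : bounded_op T -> {morph T : x y / x + y}.
Proof. by case=> Tl _ x y; have := Tl 1 x y; rewrite !scale1r. Qed.
Lemma bounded_op0 T : bounded_op T -> T 0 = 0.
Proof.
by case=> Tl _; have := Tl (-1) 0 0; rewrite !scaleN1r oppr0 addr0 addNr.
Qed.
Lemma bounded_opZ T : bounded_op T -> forall c x, T (c *: x) = c *: T x.
Proof.
by move=> hT c x; have [Tl _] := hT; have := Tl c x 0; rewrite (bounded_op0 hT) !addr0.
Qed.
Lemma bounded_op_sum T (I : Type) (r : seq I) (F : I -> H) : bounded_op T ->
  T (\sum_(s <- r) F s) = \sum_(s <- r) T (F s).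
Proof.
move=> hT; elim: r => [|s r IH]; first by rewrite !big_nil bounded_op0.
by rewrite !big_cons bounded_opD // IH.
Qed.

Lemma bounded_op_id : bounded_op (id : H -> H).
Proof. by split=> // x; exact: cvg_id. Qed.
Lemma bounded_op_zero : bounded_op (fun _ : H => 0 : H).
Proof. by split=> [c x y|x]; [rewrite scaler0 addr0|exact: cvg_cst]. Qed.
Lemma bounded_op_add S T : bounded_op S -> bounded_op T ->
  bounded_op (fun x => S x + T x).
Proof.
case=> Sl Sc [Tl Tc]; split=> [c x y|x].
  by rewrite Sl Tl scalerDr addrACA.
by apply: cvgD; [exact: Sc|exact: Tc].
Qed.
Lemma bounded_op_scale c T : bounded_op T -> bounded_op (fun x => c *: T x).
Proof.
case=> Tl Tc; split=> [a x y|x].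
  by rewrite Tl scalerDr !scalerA mulrC.
by apply: cvgZr; exact: Tc.
Qed.
Lemma bounded_op_opp T : bounded_op T -> bounded_op (fun x => - T x).
Proof.
move=> hT; have := bounded_op_scale (-1) hT.
by under eq_fun do rewrite scaleN1r.
Qed.
Lemma bounded_op_comp S T : bounded_op S -> bounded_op T ->
  bounded_op (fun x => S (T x)).
Proof.
case=> Sl Sc [Tl Tc]; split=> [c x y|x]; first by rewrite Tl Sl.
by apply: continuous_comp; [exact: Tc|exact: Sc].
Qed.
End LinearOperators.

(** * Orthonormal bases *)

Section Basis.
Context {R : realType} {H : completeNormedModType R[i]}.
Context {dot : {dot H for Num.conj}} (hdot : hilbert_norm dot).
Context {I : countType} {rg : pred I} {e : I -> H}.
Context (he : orthonormal_basis dot rg e).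
Implicit Types (x y z : H) (c : I -> R[i]) (s t : I) (r : seq I).
Local Notation "x %:C" := (real_complex R x).

Lemma norm_eps_eq0 (V : normedModType R[i]) (v : V) (K : R) :
  (forall eps : R, 0 < eps -> `|v| <= (K * eps)%:C) -> v = 0.
Proof.
move=> h; have [u u0 uE] := norm_complexP v.
apply/eqP; rewrite -normr_eq0 uE; apply/eqP; congr (_%:C).
apply/eqP; rewrite eq_le u0 andbT leNgt; apply/negP => {}u0.
have K0 : 0 < K.
  by have := h 1 ltr01; rewrite uE lecR mulr1 => /(lt_le_trans u0).
have hh : 0 < u / (2 * K) by rewrite divr_gt0 // mulr_gt0.
have := h _ hh; rewrite uE lecR.
have -> : K * (u / (2 * K)) = u / 2 by field; rewrite gt_eqF // ?mulr_gt0.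
lra.
Qed.

Lemma dot_basis s t : dot (e s) (e t) = (rg s && (s == t))%:R.
Proof.
have [h1 _ h3] := he.
have [rs|rs] := boolP (rg s); last by rewrite h3 // dot0l.
have [rt|rt] := boolP (rg t); first by rewrite h1.
rewrite (h3 t) // dot0r; case: eqP => // st; by rewrite -st rs in rt.
Qed.

Lemma basis_out s : ~~ rg s -> e s = 0.
Proof. by have [_ _] := he; apply. Qed.

Lemma basis_dense x (eps : R) : 0 < eps ->
  exists r c, all rg r /\ `|x - \sum_(s <- r) c s *: e s| < eps%:C.
Proof.
move=> eps0; have [_ h _] := he.
have : closure [set x | exists r c, all rg r /\ x = \sum_(s <- r) c s *: e s] x.
  by rewrite h.
move=> /(_ (ball x eps%:C)) [|z [[r [c [rr ->]]]]].
  by apply: nbhsx_ballx; rewrite ltcR.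
by rewrite -ball_normE /= => ?; exists r, c.
Qed.

(** The span of the basis is dense, and a bounded linear map moves a small
    error to a small error. *)
Lemma vanish_on_basis (V : normedModType R[i]) (f : H -> V) (K : R) :
  linear f -> bounded_by f K -> (forall s, rg s -> f (e s) = 0) ->
  forall x, f x = 0.
Proof.
move=> fl fK fe x.
have f0 : f 0 = 0 by have := fl (-1) 0 0; rewrite !scaleN1r oppr0 addr0 addNr.
have fsum r c : all rg r -> f (\sum_(s <- r) c s *: e s) = 0.
  elim: r => [|s r IH] /=; first by rewrite big_nil f0.
  by case/andP=> rs /IH; rewrite big_cons fl fe // scaler0 add0r.
apply: (@norm_eps_eq0 _ _ `|K|) => eps eps0.
have [r [c [rr h]]] := basis_dense x eps0.
have -> : f x = f (x - \sum_(s <- r) c s *: e s).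
  by rewrite addrC -scaleN1r fl fsum // scaler0 add0r.
apply: le_trans (fK _) _; rewrite rmorphM /=.
apply: le_trans (_ : `|K|%:C * `|x - \sum_(s <- r) c s *: e s| <= _).
  by apply: ler_wpM2r => //; rewrite lecR ler_norm.
by apply: ler_wpM2l; [rewrite lecR | exact: ltW].
Qed.

Lemma bounded_op_eq (S T : H -> H) : bounded_op S -> bounded_op T ->
  (forall s, rg s -> S (e s) = T (e s)) -> S = T.
Proof.
move=> hS hT h; apply/funext => x; apply/eqP; rewrite -subr_eq0; apply/eqP.
have hB := bounded_op_add hS (bounded_op_opp hT).
have [K _ hK] := bounded_op_bound hB.
apply: (vanish_on_basis hB.1 hK) => s rs; by rewrite h // subrr.
Qed.

(** If z in the span is close to x then <x, z> = 0 gives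
    |x|^2 = <x, x - z> <= |x| |x - z|. *)
Lemma dot_basis_eq0 x : (forall s, rg s -> dot x (e s) = 0) -> x = 0.
Proof.
move=> h; apply: (@norm_eps_eq0 _ _ 1) => eps eps0; rewrite mul1r.
have [r [c [rr hz]]] := basis_dense x eps0.
set z := \sum_(s <- r) _ in hz.
have xz : dot x z = 0.
  rewrite dotC dot_suml big_seq big1 ?rmorph0 // => s sr.
  by rewrite dotZl dotC h ?rmorph0 ?mulr0 // (allP rr).
have [->|x0] := eqVneq x 0; first by rewrite normr0 ler0c ltW.
apply: le_trans (ltW hz).
have : `|x| * `|x| <= `|x| * `|x - z|.
  rewrite -expr2 hdot -[X in X <= _]subr0 -xz -dotBr.
  apply: le_trans (cauchy_schwarz hdot _ _).
  rewrite real_ler_norm // dotBr xz subr0 -hdot; apply: realX; exact: normr_real.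
by rewrite ler_pM2l // normr_gt0.
Qed.

Lemma dot_basis_inj x y : (forall s, rg s -> dot x (e s) = dot y (e s)) -> x = y.
Proof.
move=> h; apply/eqP; rewrite -subr_eq0; apply/eqP/dot_basis_eq0 => s rs.
by rewrite dotBl h // subrr.
Qed.

Lemma dot_sum_basis r c t : uniq r -> rg t ->
  dot (\sum_(s <- r) c s *: e s) (e t) = if t \in r then c t else 0.
Proof.
move=> ur rt; rewrite dot_suml.
under eq_bigr => s _ do rewrite dotZl dot_basis.
case: ifPn => tr.
  rewrite (bigD1_seq t) //= rt eqxx mulr1 big1 ?addr0 // => s /negPf ->.
  by rewrite andbF mulr0.
rewrite big_seq big1 // => s sr; case: eqP => [st|]; last by rewrite andbF mulr0.
by rewrite -st sr in tr.
Qed.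

Lemma norm_sum_basis r c : uniq r -> all rg r ->
  `|\sum_(s <- r) c s *: e s| ^+ 2 = \sum_(s <- r) `|c s| ^+ 2.
Proof.
move=> ur rr; rewrite hdot {1}dot_suml; apply: eq_big_seq => s sr.
rewrite dotZl dotC dot_sum_basis // ?(allP rr) // sr normCK //.
Qed.

(** The left-hand side is the square of the norm of a partial sum z of x, and
    also equal to <x, z> and <z, x>; then expand 0 <= |x - z|^2. *)
Lemma bessel x r : uniq r -> \sum_(s <- r) `|dot x (e s)| ^+ 2 <= `|x| ^+ 2.
Proof.
wlog rr : r / all rg r => [th|] ur.
  have -> : \sum_(s <- r) `|dot x (e s)| ^+ 2 =
      \sum_(s <- [seq s <- r | rg s]) `|dot x (e s)| ^+ 2.
    rewrite big_filter [RHS]big_mkcond /=; apply: eq_bigr => s _.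
    by case: ifPn => // /basis_out ->; rewrite dot0r normr0 expr0n.
  by apply: th; rewrite ?filter_all ?filter_uniq.
set z := \sum_(s <- r) dot x (e s) *: e s.
have zz : dot z z = \sum_(s <- r) `|dot x (e s)| ^+ 2.
  by rewrite -hdot norm_sum_basis.
have zx : dot z x = \sum_(s <- r) `|dot x (e s)| ^+ 2.
  rewrite dot_suml; apply: eq_bigr => s _.
  by rewrite dotZl [X in _ * X]dotC normCK.
have xz : dot x z = \sum_(s <- r) `|dot x (e s)| ^+ 2.
  by rewrite dotC zx -zz conj_Creal // ger0_real // dnorm_ge0.
have := dnorm_ge0 dot (x - z).
by rewrite dotBl !dotBr xz zx zz subrr subr0 -hdot subr_ge0.
Qed.

(** Finite sets of indices that grow to the whole of rg; [pickle_inv] makes the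
    enumeration injective, so that no index is repeated. *)
Definition first_indices n : seq I := [seq s <- pmap pickle_inv (iota 0 n) | rg s].

Lemma first_indices_uniq n : uniq (first_indices n).
Proof. exact/filter_uniq/(pmap_uniq (@pickle_invK _))/iota_uniq. Qed.

Lemma first_indices_all n : all rg (first_indices n).
Proof. exact: filter_all. Qed.

Lemma first_indicesD m n : (m <= n)%N ->
  exists2 r, first_indices n = first_indices m ++ r & uniq r && all rg r.
Proof.
move=> mn; exists [seq s <- pmap pickle_inv (iota m (n - m)) | rg s].
  by rewrite -filter_cat -pmap_cat -iotaD subnKC.
by rewrite filter_all filter_uniq // (pmap_uniq (@pickle_invK _)) // iota_uniq.
Qed.

Lemma mem_first_indices t n : rg t -> (pickle t < n)%N -> t \in first_indices n.
Proof.
move=> rt tn; rewrite mem_filter rt mem_pmap; apply/mapP.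
by exists (pickle t); rewrite ?mem_iota //= pickleK_inv.
Qed.

(** The partial sums of sum_s c_s e_s form a Cauchy sequence since their
    distances are differences of the bounded nondecreasing sequence of partial
    sums of |c_s|^2; their limit has the coefficients c. *)
Lemma riesz_fischer c (K : R) :
  (forall r, uniq r -> all rg r -> \sum_(s <- r) `|c s| ^+ 2 <= K%:C) ->
  exists2 y, `|y| ^+ 2 <= K%:C & forall t, rg t -> dot y (e t) = c t.
Proof.
move=> hK.
pose y n := \sum_(s <- first_indices n) c s *: e s.
pose S n := complex.Re (\sum_(s <- first_indices n) `|c s| ^+ 2).
have SE n : (S n)%:C = \sum_(s <- first_indices n) `|c s| ^+ 2.
  by rewrite RRe_real // ger0_real // sumr_ge0 // => s _; exact: exprn_ge0.
have ydiff m n : (m <= n)%N -> `|y n - y m| ^+ 2 = (S n - S m)%:C.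
  move=> /first_indicesD [r rE /andP[ur rr]].
  rewrite rmorphB /= !SE /y rE !big_cat /=.
  by rewrite ![_ + _ - _]addrAC !subrr !add0r norm_sum_basis.
have SK n : S n <= K.
  by rewrite -lecR SE hK ?first_indices_uniq ?first_indices_all.
have hsup : has_sup (range S).
  by split; [exists (S 0), 0%N | exists K => _ [n _ <-]].
have ycauchy : cauchy (y @ \oo).
  apply: cauchy_exP => _ /pos_complexP [eps eps0 ->].
  have [_ [n _ <-] hn] := sup_adherent (exprn_gt0 2 eps0) hsup.
  exists (y n); exists n => // m /= nm; rewrite -ball_normE /=.
  rewrite distrC -(@ltr_pXn2r _ 2) ?nnegrE ?lecR //; last exact: ltW.
  rewrite ydiff // -rmorphXn ltcR.
  have : S m <= sup (range S) by apply: ub_le_sup; [exact: hsup.2|exists m].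
  lra.
have yl : y n @[n --> \oo] --> lim (y n @[n --> \oo]).
  exact: cauchy_cvg ycauchy.
set l := lim _ in yl.
have close (eps : R) n : 0 < eps -> exists2 m, (n <= m)%N & `|l - y m| < eps%:C.
  move=> eps0; have eps0' : 0 < eps%:C by rewrite ltcR.
  have [N _ hN] := (cvgrPdist_lt _ _).1 yl _ eps0'.
  exists (maxn n N); first exact: leq_maxl.
  by apply: hN; exact: leq_maxr.
exists l; last first.
  move=> t rt; apply/eqP; rewrite -subr_eq0; apply/eqP.
  apply: (@norm_eps_eq0 R[i]^o _ 1) => eps eps0; rewrite mul1r.
  have [m tm lm] := close _ (pickle t).+1 eps0.
  have <- : dot (y m) (e t) = c t.
    by rewrite dot_sum_basis ?first_indices_uniq // mem_first_indices.
  rewrite -dotBl; apply: le_trans (cauchy_schwarz hdot _ _) _.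
  have -> : `|e t| = 1.
    apply/eqP; rewrite -(@eqrXn2 _ 2) // expr1n.
    by rewrite hdot dot_basis rt eqxx.
  by rewrite mulr1 ltW.
have [u u0 uE] := norm_complexP l; rewrite uE -rmorphXn lecR.
rewrite leNgt; apply/negP => Ku.
have K0 : 0 <= K by apply: le_trans (SK 0%N); rewrite -ler0c SE sumr_ge0.
have ku : Num.sqrt K < u.
  by rewrite -(@ltr_pXn2r _ 2) ?nnegrE ?sqrtr_ge0 ?sqr_sqrtr.
have dk : 0 < u - Num.sqrt K by rewrite subr_gt0.
have [m _ lm] := close _ 0%N dk.
suff : u%:C < u%:C by rewrite ltxx.
rewrite -{1}uE -[X in `|X|](subrK (y m)); apply: le_lt_trans (ler_normD _ _) _.
have -> : u%:C = (u - Num.sqrt K)%:C + (Num.sqrt K)%:C by rewrite -rmorphD subrK.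
apply: ltr_leD => //.
rewrite -(@ler_pXn2r _ 2) ?nnegrE ?lecR ?sqrtr_ge0 //.
rewrite norm_sum_basis ?first_indices_uniq ?first_indices_all // -SE.
by rewrite -rmorphXn lecR sqr_sqrtr.
Qed.

(** The operator with M e_s = w (sigma s) e_(sigma s). It is described by its
    coefficients, which are square-summable by Bessel's inequality, because
    coefficients determine a vector: linearity needs no further argument. *)
Lemma weighted_op (sigma tau : I -> I) (w : I -> R) (K : R) :
  cancel sigma tau -> cancel tau sigma -> (forall t, rg t -> `|w t| <= K) ->
  exists M, [/\ bounded_op M, bounded_by M `|K| &
    forall x t, rg t -> dot (M x) (e t) = (w t)%:C * dot x (e (tau t))].
Proof.
move=> st ts wK.
have /choice[M hM] x : exists y, `|y| <= `|K|%:C * `|x| /\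
    forall t, rg t -> dot y (e t) = (w t)%:C * dot x (e (tau t)).
  have [u u0 uE] := norm_complexP x.
  have [|y yn ye] := @riesz_fischer (fun t => (w t)%:C * dot x (e (tau t))) (`|K| ^+ 2 * u ^+ 2).
    move=> r ur rr.
    apply: (@le_trans _ _ (\sum_(s <- r) (`|K|^+2)%:C * `|dot x (e (tau s))| ^+ 2)).
      rewrite big_seq [X in _ <= X]big_seq; apply: ler_sum => s sr.
      rewrite normrM exprMn; apply: ler_wpM2r; first exact: exprn_ge0.
      rewrite rmorphXn /= norm_real_complex ler_pXn2r ?nnegrE ?ler0c // lecR.
      by apply: le_trans (wK _ (allP rr _ sr)) (ler_norm _).
    rewrite -mulr_sumr -(big_map tau predT (fun s => `|dot x (e s)| ^+ 2)).
    rewrite [X in _ <= X]rmorphM /=; apply: ler_wpM2l; first by rewrite ler0c exprn_ge0.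
    rewrite rmorphXn /= -uE; apply: bessel; rewrite map_inj_uniq //.
    exact: can_inj ts.
  exists y; split=> //.
  rewrite -(@ler_pXn2r _ 2) ?nnegrE ?mulr_ge0 ?lecR //.
  by rewrite uE exprMn -!rmorphXn -rmorphM.
have Ml : linear M.
  move=> a x y; apply: dot_basis_inj => t rt.
  by rewrite dotDl dotZl !(hM _).2 // dotDl dotZl mulrDr mulrCA.
have MK : bounded_by M `|K| by move=> x; exact: (hM x).1.
exists M; split=> //; first exact: bounded_op_by MK.
by move=> x; exact: (hM x).2.
Qed.

End Basis.

(** * Adjoint pairs and weighted translations *)

Section Adjoints.
Context {R : realType} {H : completeNormedModType R[i]}.
Context {dot : {dot H for Num.conj}} (hdot : hilbert_norm dot).
Implicit Types (x y z : H) (a b S T : H -> H).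
Local Notation "x %:C" := (real_complex R x).

(** Bounded operators with a known bounded adjoint. Working inside this class
    avoids the general existence of adjoints. *)
Definition adjoint_pair a b :=
  [/\ bounded_op a, bounded_op b & adjoint_of dot a b].

Lemma adjoint_sym a b : adjoint_of dot a b -> adjoint_of dot b a.
Proof. by move=> ab x y; rewrite [LHS]dotC -ab [RHS]dotC. Qed.

Lemma adjoint_pair_sym a b : adjoint_pair a b -> adjoint_pair b a.
Proof. by case=> ? ? /adjoint_sym. Qed.

Lemma adjoint_unique a b b' : adjoint_of dot a b -> adjoint_of dot a b' -> b = b'.
Proof.
move=> ab ab'; apply/funext => y; apply: (@dot_inj _ _ dot) => z.
by rewrite (adjoint_sym ab) (adjoint_sym ab').
Qed.

Lemma adjoint_pair_id : adjoint_pair id id.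
Proof. by split=> //; exact: bounded_op_id. Qed.

Lemma adjoint_pair_zero : adjoint_pair (fun=> 0) (fun=> 0).
Proof.
by split=> [||x y]; [exact: bounded_op_zero|exact: bounded_op_zero|rewrite dot0l dot0r].
Qed.

Lemma adjoint_pair_add a a' b b' : adjoint_pair a a' -> adjoint_pair b b' ->
  adjoint_pair (fun x => a x + b x) (fun x => a' x + b' x).
Proof.
move=> [ha ha' aa'] [hb hb' bb']; split; [exact: bounded_op_add|exact: bounded_op_add|].
by move=> x y; rewrite dotDl dotDr aa' bb'.
Qed.

Lemma adjoint_pair_scale (c : R[i]) a a' : adjoint_pair a a' ->
  adjoint_pair (fun x => c *: a x) (fun x => Num.conj c *: a' x).
Proof.
move=> [ha ha' aa']; split; [exact: bounded_op_scale|exact: bounded_op_scale|].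
by move=> x y; rewrite dotZl dotZr conjCK aa'.
Qed.

Lemma adjoint_pair_opp a a' : adjoint_pair a a' ->
  adjoint_pair (fun x => - a x) (fun x => - a' x).
Proof.
move=> [ha ha' aa']; split; [exact: bounded_op_opp|exact: bounded_op_opp|].
by move=> x y; rewrite dotNl dotNr aa'.
Qed.

Lemma adjoint_pair_comp a a' b b' : adjoint_pair a a' -> adjoint_pair b b' ->
  adjoint_pair (fun x => a (b x)) (fun x => b' (a' x)).
Proof.
move=> [ha ha' aa'] [hb hb' bb']; split; [exact: bounded_op_comp|exact: bounded_op_comp|].
by move=> x y; rewrite aa' bb'.
Qed.
End Adjoints.
Arguments adjoint_pair {R H} dot a b.

Section WeightedPairs.
Context {R : realType} {H : completeNormedModType R[i]}.
Context {dot : {dot H for Num.conj}} (hdot : hilbert_norm dot).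
Context {I : countType} {rg : pred I} {e : I -> H}.
Context (he : orthonormal_basis dot rg e).
Implicit Types (x y z : H) (s t : I).
Local Notation "x %:C" := (real_complex R x).

(** The weights only matter where both s and sigma s are indices: elsewhere
    e_s or e_(sigma s) is zero. This is why no bound is asked there. *)
Lemma weighted_pair (sigma tau : I -> I) (w : I -> R) (K : R) :
  cancel sigma tau -> cancel tau sigma ->
  (forall s, rg s -> rg (sigma s) -> `|w s| <= K) ->
  exists M M', [/\ adjoint_pair dot M M', bounded_by M `|K|,
    forall s, rg s -> M (e s) = (w s)%:C *: e (sigma s) &
    forall t, rg t -> M' (e t) = (w (tau t))%:C *: e (tau t)].
Proof.
move=> st ts wK.
pose w' s := if rg s && rg (sigma s) then w s else 0.
have w'K s : `|w' s| <= `|K|.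
  rewrite /w'; case: ifPn => [/andP[rs rss]|_]; last by rewrite normr0.
  by apply: le_trans (wK _ rs rss) (ler_norm _).
have [M [Mb MK hM]] := weighted_op hdot he st ts (fun t _ => w'K (tau t)).
have [M' [M'b _ hM']] := weighted_op hdot he ts st (fun s _ => w'K s).
have Me s : rg s -> M (e s) = (w s)%:C *: e (sigma s).
  move=> rs; apply: (dot_basis_inj hdot he) => t rt.
  rewrite hM // dotZl !(dot_basis he) rs /= /w' ts rt andbT.
  have [E|ne] := eqVneq s (tau t); first by rewrite -E rs E ts rt eqxx.
  case: eqP => [E|]; first by rewrite -E st eqxx in ne.
  by rewrite andbF !mulr0.
have M'e t : rg t -> M' (e t) = (w (tau t))%:C *: e (tau t).
  move=> rt; apply: (dot_basis_inj hdot he) => s rs.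
  rewrite hM' // dotZl !(dot_basis he) rt /= /w' rs /=.
  have [E|ne] := eqVneq t (sigma s); first by rewrite -E rt E st rs eqxx.
  case: eqP => [E|]; first by rewrite -E ts eqxx in ne.
  by rewrite andbF !mulr0.
exists M, M'; split=> //; last by move=> x; have := MK x; rewrite normr_id.
split=> // x y; apply/eqP; rewrite -subr_eq0; apply/eqP.
pose f x : R[i]^o := dot (M x) y - dot x (M' y).
have fl : linear f.
  move=> c u v; rewrite /f (Mb.1 c u v) !dotDl !dotZl scalerBr.
  by rewrite opprD addrACA.
have [u u0 uE] := norm_complexP y; have [v v0 vE] := norm_complexP (M' y).
have fK : bounded_by f (`|K| * u + v).
  move=> z; rewrite /f; apply: le_trans (ler_normB _ _) _.
  rewrite rmorphD rmorphM mulrDl /= -uE -vE; apply: lerD; last first.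
    by rewrite mulrC; exact: cauchy_schwarz.
  apply: le_trans (cauchy_schwarz hdot _ _) _; rewrite mulrAC; apply: ler_wpM2r => //.
  by have := MK z; rewrite normr_id.
apply: (vanish_on_basis he fl fK) => s rs.
rewrite /f Me // dotZl [X in _ - X]dotC hM' // rmorphM /= conj_realC -dotC /w' rs.
case: ifPn => [_|/(basis_out he) ->]; first by rewrite subrr.
by rewrite dot0l !mulr0 subrr.
Qed.

Lemma diagonal_pair (w : I -> R) (K : R) : (forall s, rg s -> `|w s| <= K) ->
  exists M, [/\ adjoint_pair dot M M, bounded_by M `|K| &
    forall s, rg s -> M (e s) = (w s)%:C *: e s].
Proof.
move=> wK.
have [s //|M [M' [MM' MK Me M'e]]] := @weighted_pair id id w K (fun=> erefl) (fun=> erefl).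
  by move=> rs _; exact: wK.
exists M; split=> //; have [Mb M'b _] := MM'.
suff {2}-> : M = M' by [].
by apply: (bounded_op_eq he) => // s rs; rewrite Me ?M'e.
Qed.

Lemma diagonal_dot M (w : I -> R) : adjoint_pair dot M M ->
  (forall s, rg s -> M (e s) = (w s)%:C *: e s) ->
  forall x s, rg s -> dot (M x) (e s) = (w s)%:C * dot x (e s).
Proof. by move=> [_ _ a] Me x s rs; rewrite a Me // dotZr conj_realC. Qed.
End WeightedPairs.

(** * Operators with bounded commutator *)

Section Regular.
Context {R : realType} {H : completeNormedModType R[i]}.
Context {dot : {dot H for Num.conj}} (hdot : hilbert_norm dot).
Context (T : H -> H) (hT : adjoint_pair dot T T).
Implicit Types (x y z : H) (a b : H -> H).

(** Here T is the inverse of D, that is, D x y stands for x = T y. Then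
    B = [D, a] can be stated with bounded operators only: a T = T (B T + a).
    The adjoints a' and B' are part of the definition because the commutator
    with a' is - B'. *)
Definition regular a := exists a' B B', [/\ adjoint_pair dot a a',
  adjoint_pair dot B B' & forall y, a (T y) = T (B (T y) + a y)].

Let TD : {morph T : x y / x + y}.
Proof. by have [h _ _] := hT; exact: bounded_opD. Qed.
Let TZ : forall c x, T (c *: x) = c *: T x.
Proof. by have [h _ _] := hT; exact: bounded_opZ. Qed.
Let Tadj : forall x y, dot (T x) y = dot x (T y).
Proof. by have [_ _ h] := hT. Qed.

Lemma regular_id : regular id.
Proof.
exists id, (fun=> 0), (fun=> 0); split=> [||y]; last by rewrite add0r.
  exact: adjoint_pair_id.
exact: adjoint_pair_zero.
Qed.

Lemma regular_add a b : regular a -> regular b -> regular (fun x => a x + b x).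
Proof.
move=> [a' [B [B' [aa BB h]]]] [b' [C [C' [bb CC k]]]].
do 3 eexists; split; [exact: adjoint_pair_add aa bb|exact: adjoint_pair_add BB CC|].
by move=> y; rewrite h k -TD addrACA.
Qed.

Lemma regular_scale c a : regular a -> regular (fun x => c *: a x).
Proof.
move=> [a' [B [B' [aa BB h]]]].
do 3 eexists; split; [exact: adjoint_pair_scale aa|exact: adjoint_pair_scale BB|].
by move=> y; rewrite h -TZ scalerDr.
Qed.

(** [D, a b] = [D, a] b + a [D, b] *)
Lemma regular_comp a b : regular a -> regular b -> regular (fun x => a (b x)).
Proof.
move=> [a' [B [B' [aa BB h]]]] [b' [C [C' [bb CC k]]]].
have aD : {morph a : x y / x + y} by have [ab _ _] := aa; exact: bounded_opD.
do 3 eexists; split; [exact: adjoint_pair_comp aa bb|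
  exact: adjoint_pair_add (adjoint_pair_comp BB bb) (adjoint_pair_comp aa CC)|].
by move=> y; rewrite /= k h -k aD addrA.
Qed.

(** [D, a'] = - [D, a]' *)
Lemma regular_adj a b : regular a -> adjoint_of dot a b -> regular b.
Proof.
move=> [a' [B [B' [aa BB h]]]] ab.
have -> : b = a' by have [_ _ aa'] := aa; exact: adjoint_unique ab aa'.
exists a, (fun x => - B' x), (fun x => - B x); split.
- exact: adjoint_pair_sym.
- exact/adjoint_pair_opp/adjoint_pair_sym.
move=> y; apply: (@dot_inj _ _ dot) => z.
have [_ _ /adjoint_sym aa'] := aa; have [_ _ /adjoint_sym BB'] := BB.
rewrite aa' Tadj [RHS]Tadj dotDl dotNl aa' BB' Tadj -dotNr -dotDr; congr (dot _ _).
by rewrite h TD addKr.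
Qed.

Lemma regular_star_algebra G a :
  (forall g, G g -> regular g) -> star_algebra dot G a -> regular a.
Proof.
move=> hG; elim=> [g /hG //||b c _ rb _ rc|c b _ rb|b c _ rb _ rc|b c _ rb bc].
- exact: regular_id.
- exact: regular_add.
- exact: regular_scale.
- exact: regular_comp.
- exact: regular_adj rb bc.
Qed.

Lemma regular_bounded D a : (forall x y, D x y <-> x = T y) -> regular a ->
  bounded_op a /\ bounded_commutator D a.
Proof.
move=> DT [a' [B [B' [[ha _ _] [hB _ _] h]]]]; split=> //.
by exists B => // x y /DT ->; apply/DT; rewrite h.
Qed.

(** With x = T y, the adjoint relation for (u, v) reads <y, u> = <y, T v> for
    all y, since T is everywhere defined. *)
Lemma inverse_self_adjoint D : (forall x y, D x y <-> x = T y) ->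
  closure (dom D) = setT -> self_adjoint dot D.
Proof.
move=> DT dense; split=> // u v; split=> [/DT -> x y /DT ->|h].
  by rewrite Tadj.
apply/DT; apply: (@dot_inj _ _ dot) => y.
by rewrite [LHS]dotC (h (T y) y) ?DT // Tadj [RHS]dotC.
Qed.

End Regular.
Arguments regular {R H} dot T a.

(** * Diagonal operators: commutators and compactness *)

Section Diagonal.
Context {R : realType} {H : completeNormedModType R[i]}.
Context {dot : {dot H for Num.conj}} (hdot : hilbert_norm dot).
Context {I : countType} {rg : pred I} {e : I -> H}.
Context (he : orthonormal_basis dot rg e).
Implicit Types (x y z : H) (s t : I).
Local Notation "x %:C" := (real_complex R x).

Section Weighted.
Variables (T : H -> H) (d : I -> R).
Hypothesis hT : adjoint_pair dot T T.
Hypothesis Te : forall s, rg s -> T (e s) = ((d s)^-1)%:C *: e s.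
Hypothesis d0 : forall s, rg s -> d s != 0.

Lemma diagonal_inverse_out s : T (e s) = ((d s)^-1)%:C *: e s.
Proof.
have [/Te //|/(basis_out he) ->] := boolP (rg s).
by have [hT' _ _] := hT; rewrite bounded_op0 // scaler0.
Qed.

(** The commutator has the same index map as M, with the weights
    w s (d (sigma s) - d s). *)
Lemma regular_weighted (sigma tau : I -> I) (w : I -> R) (K L : R) :
  cancel sigma tau -> cancel tau sigma ->
  (forall s, rg s -> rg (sigma s) -> `|w s| <= K) ->
  (forall s, rg s -> rg (sigma s) -> `|w s * (d (sigma s) - d s)| <= L) ->
  exists2 M, regular dot T M &
    forall s, rg s -> M (e s) = (w s)%:C *: e (sigma s).
Proof.
move=> st ts wK wL.
have [M [M' [MM' _ Me _]]] := weighted_pair hdot he st ts wK.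
have [B [B' [BB' _ Be _]]] := weighted_pair hdot he st ts wL.
exists M => //; exists M', B, B'; split=> // y.
have [Tb _ _] := hT; have [Mb _ _] := MM'; have [Bb _ _] := BB'.
suff /(congr1 (@^~ y)) : (fun y => M (T y)) = (fun y => T (B (T y) + M y)) by [].
apply: (bounded_op_eq he); first exact: bounded_op_comp.
  apply: bounded_op_comp => //; apply: bounded_op_add => //.
  exact: bounded_op_comp.
move=> s rs; rewrite Te // (bounded_opZ Mb) (bounded_opZ Bb) Be // Me // (bounded_opD Tb).
rewrite !(bounded_opZ Tb).
rewrite diagonal_inverse_out !scalerA -scalerDl.
have [rss|/(basis_out he) ->] := boolP (rg (sigma s)); last by rewrite !scaler0.
congr (_ *: _); rewrite -!rmorphM -rmorphD; congr (_%:C).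
by field; rewrite !d0.
Qed.

Lemma regular_two_terms (a : H -> H) (sigma1 tau1 sigma2 tau2 : I -> I)
    (w1 w2 : I -> R) (K L : R) : bounded_op a ->
  cancel sigma1 tau1 -> cancel tau1 sigma1 ->
  cancel sigma2 tau2 -> cancel tau2 sigma2 ->
  (forall s, rg s -> rg (sigma1 s) ->
     `|w1 s| <= K /\ `|w1 s * (d (sigma1 s) - d s)| <= L) ->
  (forall s, rg s -> rg (sigma2 s) ->
     `|w2 s| <= K /\ `|w2 s * (d (sigma2 s) - d s)| <= L) ->
  (forall s, rg s ->
     a (e s) = (w1 s)%:C *: e (sigma1 s) + (w2 s)%:C *: e (sigma2 s)) ->
  regular dot T a.
Proof.
move=> ha st1 ts1 st2 ts2 h1 h2 ae.
have [M rM Me] := regular_weighted st1 ts1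
  (fun s r r' => (h1 s r r').1) (fun s r r' => (h1 s r r').2).
have [N rN Ne] := regular_weighted st2 ts2
  (fun s r r' => (h2 s r r').1) (fun s r r' => (h2 s r r').2).
have -> : a = (fun x => M x + N x).
  apply: (bounded_op_eq he) => //; last by move=> s rs; rewrite ae // Me // Ne.
  have [_ [_ [_ [[Mb _ _] _ _]]]] := rM; have [_ [_ [_ [[Nb _ _] _ _]]]] := rN.
  exact: bounded_op_add.
exact: regular_add.
Qed.
End Weighted.

Lemma two_terms_adjoint (a : H -> H) (sigma1 tau1 sigma2 tau2 : I -> I)
    (w1 w2 : I -> R) (K : R) : bounded_op a ->
  cancel sigma1 tau1 -> cancel tau1 sigma1 ->
  cancel sigma2 tau2 -> cancel tau2 sigma2 ->
  (forall s, rg s -> rg (sigma1 s) -> `|w1 s| <= K) ->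
  (forall s, rg s -> rg (sigma2 s) -> `|w2 s| <= K) ->
  (forall s, rg s ->
     a (e s) = (w1 s)%:C *: e (sigma1 s) + (w2 s)%:C *: e (sigma2 s)) ->
  exists2 b, adjoint_pair dot a b & forall t, rg t ->
    b (e t) = (w1 (tau1 t))%:C *: e (tau1 t) + (w2 (tau2 t))%:C *: e (tau2 t).
Proof.
move=> ha st1 ts1 st2 ts2 h1 h2 ae.
have [M [M' [MM' _ Me M'e]]] := weighted_pair hdot he st1 ts1 h1.
have [N [N' [NN' _ Ne N'e]]] := weighted_pair hdot he st2 ts2 h2.
exists (fun x => M' x + N' x); last by move=> t rt; rewrite M'e // N'e.
suff -> : a = (fun x => M x + N x) by exact: adjoint_pair_add.
apply: (bounded_op_eq he) => //; last by move=> s rs; rewrite ae // Me // Ne.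
by have [Mb _ _] := MM'; have [Nb _ _] := NN'; exact: bounded_op_add.
Qed.

(** The cluster point given by compactness of [-C, C] is a limit: an
    ultrafilter contains either a neighbourhood of it or its complement, and
    the complement does not meet that neighbourhood. *)
Lemma ultra_real_limit (F : set_system H) (g : H -> R) (C : R) :
  UltraFilter F -> F [set x | `|g x| <= C] ->
  exists a : R, forall eps : R, 0 < eps -> F [set x | `|g x - a| < eps].
Proof.
move=> FU gC.
have [|a [_ ga]] := @segment_compact R (- C) C (g @ F) _.
  by rewrite /fmap /=; apply: filterS gC => x /=; rewrite in_itv /= ler_norml.
exists a => eps eps0.
have [//|FN] := in_ultra_setVsetC [set x | `|g x - a| < eps] FU.
have [|z [/= zN zB]] := ga [set z | ~ `|z - a| < eps] (ball a eps) FN.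
  exact: nbhsx_ballx.
by case: zN; rewrite distrC; move: zB; rewrite -ball_normE.
Qed.

Lemma ultra_complex_limit (F : set_system H) (g : H -> R[i]) (C : R) :
  UltraFilter F -> F [set x | `|g x| <= C%:C] ->
  exists a : R[i], forall eps : R, 0 < eps -> F [set x | `|g x - a| < eps%:C].
Proof.
move=> FU gC.
have reC (u : R[i]) : `|u| <= C%:C -> `|complex.Re u| <= C.
  by move=> h; rewrite -lecR; apply: le_trans (normc_ge_Re u) h.
have imC (u : R[i]) : `|u| <= C%:C -> `|complex.Im u| <= C.
  move=> h; rewrite -normrN -ReiNIm; apply: reC.
  by rewrite normrM complexiE normCi mulr1.
have [a ha] := ultra_real_limit FU (filterS (fun x => reC (g x)) gC).
have [b hb] := ultra_real_limit FU (filterS (fun x => imC (g x)) gC).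
exists (Complex a b) => eps eps0.
have e2 : 0 < eps / 2 by rewrite divr_gt0.
apply: (filterS2 _ _ (ha _ e2) (hb _ e2)) => x /= h1 h2.
have -> : g x - Complex a b = (complex.Re (g x) - a)%:C + Complex 0 1 * (complex.Im (g x) - b)%:C.
  by rewrite [LHS]complexE !raddfB.
apply: (le_lt_trans (ler_normD _ _)).
rewrite normrM complexiE normCi mul1r !norm_real_complex -rmorphD ltcR.
lra.
Qed.

(** Let F be an ultrafilter on the closure of the image of the unit ball. Each
    coefficient has a limit along F. Outside a finite set r of indices, T is
    smaller than eps, so that a point of the closure is close to its partial
    sum over r, and this partial sum converges along F. So F is Cauchy. *)
Lemma diagonal_compact (T : H -> H) (w : I -> R) : bounded_op T ->
  (forall s, rg s -> T (e s) = (w s)%:C *: e s) ->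
  (forall eps : R, 0 < eps ->
     exists r : seq I, forall s, rg s -> s \notin r -> `|w s| <= eps) ->
  compact_op T.
Proof.
move=> hT Te small; split=> //.
set K := closure _.
rewrite compact_ultra => F FU FK.
have [C C0 hC] := bounded_op_bound hT.
have near x (eta : R) : K x -> 0 < eta ->
    exists2 u, `|u| <= 1 & `|x - T u| < eta%:C.
  move=> Kx eta0; have [|_ [[u u1 <-] h]] := Kx (ball x eta%:C).
    by apply: nbhsx_ballx; rewrite ltcR.
  by exists u => //; move: h; rewrite -ball_normE.
have KC x : K x -> `|x| <= (C + 1)%:C.
  move=> /near/(_ ltr01)[u u1 h]; rewrite -[x](subrK (T u)).
  apply: le_trans (ler_normD _ _) _; rewrite addrC rmorphD.
  apply: lerD; last exact: ltW.
  apply: le_trans (hC u) _; rewrite -[X in _ <= X]mulr1; apply: ler_wpM2l => //.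
  by rewrite ler0c ltW.
have lim s : exists c : R[i], forall eps : R, 0 < eps ->
    F [set x | `|dot x (e s) - c| < eps%:C].
  have [v v0 vE] := norm_complexP (e s).
  apply: (@ultra_complex_limit _ _ ((C + 1) * v)) => //.
  apply: filterS FK => x /KC xC /=; apply: le_trans (cauchy_schwarz hdot _ _) _.
  by rewrite vE rmorphM; apply: ler_wpM2r => //; rewrite ler0c.
have {lim}/choice[c hc] := lim.
pose proj r x := \sum_(s <- r) dot x (e s) *: e s.
have limr (r : seq I) (eps : R) : 0 < eps ->
    F [set x | `|proj r x - \sum_(s <- r) c s *: e s| < eps%:C].
  elim: r eps => [|s r IH] eps eps0.
    by apply: filterS FK => x _ /=; rewrite /proj !big_nil subrr normr0 ltcR.
  have [v v0 vE] := norm_complexP (e s).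
  have e2 : 0 < eps / 2 by rewrite divr_gt0.
  have e3 : 0 < eps / 2 / (v + 1) by rewrite divr_gt0 // ltr_wpDl.
  apply: (filterS2 _ _ (IH _ e2) (hc s _ e3)) => x /= h1 h2.
  rewrite /proj !big_cons opprD addrACA -scalerBl.
  apply: le_lt_trans (ler_normD _ _) _.
  rewrite normrZ vE [eps]splitr rmorphD; apply: ler_ltD => //.
  apply: le_trans (ler_wpM2r _ (ltW h2)) _; first by rewrite ler0c.
  rewrite -rmorphM lecR mulrAC ler_pdivrMr ?ltr_wpDl //.
  by rewrite ler_wpM2l ?lerDl // ltW.
have Fcauchy : cauchy F.
  apply: cauchy_exP => _ /pos_complexP [eps eps0 ->].
  have e3 : 0 < eps / 3 by rewrite divr_gt0.
  have [r hr] := small _ e3.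
  have projb : bounded_op (fun x => x - proj (undup r) x).
    apply: (bounded_op_add (@bounded_op_id _ _)).
    apply: bounded_op_opp; rewrite /proj.
    elim: (undup r) => [|s l IH].
      by under eq_fun do rewrite big_nil; exact: bounded_op_zero.
    under eq_fun do rewrite big_cons.
    apply: bounded_op_add => //.
    exact: rank_one_bounded.
  have [L L0 hL] := bounded_op_bound projb.
  have [|N [[Nb _ _] hN Ne]] := @diagonal_pair _ _ _ hdot _ _ _ he
      (fun s => if s \in r then 0 else w s) (eps / 3).
    move=> s rs; case: ifPn => sr; first by rewrite normr0 ltW.
    exact: hr.
  have NE : (fun x => T x - proj (undup r) (T x)) = N.
    apply: (bounded_op_eq he) => //.
      exact: (bounded_op_comp projb hT).
    move=> s rs; rewrite Te // Ne //.
    apply: (dot_basis_inj hdot he) => t rt.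
    rewrite dotBl (dot_sum_basis he) ?undup_uniq // mem_undup !dotZl !(dot_basis he) rs /=.
    case: eqP => [<-|_]; last by rewrite !mulr0 if_same subrr.
    by case: ifP => _; rewrite !mulr1 ?subrr ?subr0.
  exists (\sum_(s <- undup r) c s *: e s).
  apply: (filterS2 _ _ FK (limr (undup r) _ e3)) => x /= Kx hx.
  rewrite -ball_normE /= distrC.
  have -> : x - \sum_(s <- undup r) c s *: e s =
     (x - proj (undup r) x) + (proj (undup r) x - \sum_(s <- undup r) c s *: e s).
    by rewrite addrA subrK.
  apply: le_lt_trans (ler_normD _ _) _.
  have -> : eps%:C = (eps / 3 + eps / 3)%:C + (eps / 3)%:C.
    by rewrite -rmorphD; congr (_%:C); lra.
  apply: ler_ltD => //.
  have [|u u1 hu] := near x (eps / 3 / L) Kx; first by rewrite divr_gt0.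
  have -> : x - proj (undup r) x =
      ((x - T u) - proj (undup r) (x - T u)) + (T u - proj (undup r) (T u)).
    by have := bounded_opD projb (x - T u) (T u); rewrite /= subrK.
  apply: le_trans (ler_normD _ _) _; rewrite rmorphD; apply: lerD.
    apply: le_trans (hL _) _.
    apply: le_trans (ler_wpM2l _ (ltW hu)) _; first by rewrite ler0c ltW.
    by rewrite -rmorphM lecR mulrC divfK // gt_eqF.
  have -> : T u - proj (undup r) (T u) = N u by rewrite -NE.
  apply: le_trans (hN u) _; rewrite ger0_norm; last exact: ltW.
  by rewrite -[X in _ <= X]mulr1; apply: ler_wpM2l => //; rewrite ler0c ltW.
have Fl : F --> lim F by exact: cauchy_cvg Fcauchy.
exists (lim F); split=> //.
apply: closed_closure => B /Fl FB.
exact: filter_ex (filterI FK FB).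
Qed.

End Diagonal.

(** * The coefficients of alpha and beta *)

Lemma basis_indexP (n i j : int) : basis_index (n, i, j) ->
  [/\ 0 <= n, 0 <= n - i, 0 <= n + i, 0 <= n - j & 0 <= n + j].
Proof. move=> /and4P[h1 h2 _ _]; split; lia. Qed.

Section Coefficients.
Context {R : realType} {q : R} (hq : 0 < q < 1).
Implicit Types (n i j k : int).

Local Notation p := (Num.sqrt q).
(** The coefficients split into products of qp k = q^(k/2),
    qs k = (1 - q^k)^(1/2) and, for the edge between levels n and n + 1, the
    common denominator qc n. Division by zero makes qc (-1) = 0, in agreement
    with the absence of a level -1. *)
Definition qp k : R := p ^ k.
Definition qs k : R := Num.sqrt (1 - q ^ k).
Definition qc n : R := (qs (n + n + 2) * qs (n + n + 4))^-1.

(** a_+, a_-, b_+, b_- in factored form; they agree with the square roots of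
    the statement on indices, and vanish whenever they lead from outside of
    the index set into it. *)
Definition aP n i j := qp n * qp n * qp i * qp j * q * qs (n - j + 2) * qs (n - i + 2) * qc n.
Definition aM n i j := qs (n + j) * qs (n + i) * qc (n - 1).
Definition bP n i j := - (qp n * qp j * qs (n - j + 2) * qs (n + i + 2) * qc n).
Definition bM n i j := qp n * qp i * qs (n + j) * qs (n - i) * qc (n - 1).

Lemma q0 : 0 < q. Proof. by have /andP[] := hq. Qed.
Lemma q1 : q < 1. Proof. by have /andP[] := hq. Qed.
Lemma p0 : 0 < p. Proof. by rewrite sqrtr_gt0 q0. Qed.
Lemma pp : p * p = q. Proof. by rewrite -expr2 sqr_sqrtr // ltW // q0. Qed.

Lemma qpD k l : qp (k + l) = qp k * qp l.
Proof. by rewrite /qp expfzDr // gt_eqF // p0. Qed.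
Lemma qp_gt0 k : 0 < qp k. Proof. by rewrite exprz_gt0 // p0. Qed.
Lemma qp_neq0 k : qp k != 0. Proof. by rewrite gt_eqF // qp_gt0. Qed.
Lemma qpN k : qp (- k) = (qp k)^-1. Proof. by rewrite /qp invr_expz. Qed.
Lemma qp1 : qp 1 = p. Proof. by rewrite /qp expr1z. Qed.
Lemma qp0 : qp 0 = 1. Proof. by rewrite /qp expr0z. Qed.
Lemma qp2 : qp 2 = q. Proof. by rewrite -[2]/(1 + 1 : int) qpD qp1 pp. Qed.
Lemma qp4 : qp 4 = q * q. Proof. by rewrite -[4]/(2 + 2 : int) qpD qp2. Qed.
Lemma qpq k : q ^ k = qp k * qp k. Proof. by rewrite /qp -expfzMl pp. Qed.
Lemma sqrt_qpq k : Num.sqrt (q ^ k) = qp k.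
Proof. by rewrite qpq -expr2 sqrtr_sqr gtr0_norm // qp_gt0. Qed.
Lemma qpS n : qp (n + 1) = qp n * p. Proof. by rewrite qpD qp1. Qed.
Lemma qpP n : qp (n - 1) = qp n / p. Proof. by rewrite qpD qpN qp1. Qed.

Lemma qp_le1 k : 0 <= k -> qp k <= 1.
Proof.
have ple1 : p <= 1 by rewrite -(@expr_le1 _ 2) ?sqrtr_ge0 // expr2 pp ltW // q1.
by case: k => // k _; rewrite /qp -exprnP exprn_ile1 // sqrtr_ge0.
Qed.

Lemma qz_le1 k : 0 <= k -> q ^ k <= 1.
Proof. by case: k => // k _; rewrite -exprnP exprn_ile1 ?ltW ?q0 ?q1. Qed.
Lemma qz_lt1 k : 0 < k -> q ^ k < 1.
Proof. by case: k => // k k0; rewrite -exprnP exprn_ilt1 ?ltW ?q0 ?q1 //; lia. Qed.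

Lemma qs_ge0 k : 0 <= qs k. Proof. exact: sqrtr_ge0. Qed.
Lemma qs_gt0 k : 0 < k -> 0 < qs k.
Proof. by move=> k0; rewrite sqrtr_gt0 subr_gt0 qz_lt1. Qed.
Lemma qs_neq0 k : 0 < k -> qs k != 0. Proof. by move=> /qs_gt0 /gt_eqF ->. Qed.
Lemma qs0 : qs 0 = 0. Proof. by rewrite /qs expr0z subrr sqrtr0. Qed.
Lemma qsM k : 0 <= k -> qs k * qs k = 1 - qp k * qp k.
Proof. by move=> k0; rewrite -expr2 sqr_sqrtr ?qpq // subr_ge0 -qpq qz_le1. Qed.

Lemma qcM n : 0 <= n ->
  qc n * qc n = ((1 - (qp n * qp n * q) ^+ 2) * (1 - (qp n * qp n * q * q) ^+ 2))^-1.
Proof.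
move=> n0; rewrite /qc -invfM; congr (_^-1).
by rewrite mulrACA !qsM ?addr_ge0 // (qpD _ 2) (qpD _ 4) qp2 qp4 qpD; ring.
Qed.

Lemma qcN1 : qc (-1) = 0.
Proof. by rewrite /qc (_ : -1 - 1 + 2 = 0) ?qs0 ?mul0r ?invr0. Qed.

Lemma a_plusE n i j : basis_index (n, i, j) -> a_plus q n i j = aP n i j.
Proof.
move=> /basis_indexP[h0 h1 h2 h3 h4]; rewrite /a_plus /aP /qc.
have -> : 2 * n + 2 = n + n + 2 by lia.
have -> : 2 * n + 4 = n + n + 4 by lia.
rewrite sqrtrM; last by rewrite exprz_ge0 // ltW // q0.
rewrite sqrt_qpq sqrtrM; last first.
  by rewrite mulr_ge0 // subr_ge0 qz_le1 //; lia.
rewrite sqrtrV; last by rewrite mulr_ge0 // subr_ge0 qz_le1 //; lia.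
rewrite !sqrtrM ?subr_ge0 ?qz_le1 //; try lia.
by rewrite (qpD _ 2) qp2 !qpD /qs; ring.
Qed.

Lemma a_minusE n i j : basis_index (n, i, j) -> a_minus q n i j = aM n i j.
Proof.
move=> /basis_indexP[h0 h1 h2 h3 h4]; rewrite /a_minus /aM /qc.
have -> : n - 1 + (n - 1) + 2 = 2 * n by lia.
have -> : n - 1 + (n - 1) + 4 = 2 * n + 2 by lia.
rewrite sqrtrM; last first.
  by rewrite mulr_ge0 // subr_ge0 qz_le1 //; lia.
rewrite sqrtrV; last by rewrite mulr_ge0 // subr_ge0 qz_le1 //; lia.
by rewrite !sqrtrM ?subr_ge0 ?qz_le1 //; lia.
Qed.

Lemma b_plusE n i j : basis_index (n, i, j) -> b_plus q n i j = bP n i j.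
Proof.
move=> /basis_indexP[h0 h1 h2 h3 h4]; rewrite /b_plus /bP /qc.
have -> : 2 * n + 2 = n + n + 2 by lia.
have -> : 2 * n + 4 = n + n + 4 by lia.
rewrite sqrtrM; last by rewrite exprz_ge0 // ltW // q0.
rewrite sqrt_qpq sqrtrM; last first.
  by rewrite mulr_ge0 // subr_ge0 qz_le1 //; lia.
rewrite sqrtrV; last by rewrite mulr_ge0 // subr_ge0 qz_le1 //; lia.
rewrite !sqrtrM ?subr_ge0 ?qz_le1 //; try lia.
by rewrite !qpD /qs; ring.
Qed.

Lemma b_minusE n i j : basis_index (n, i, j) -> b_minus q n i j = bM n i j.
Proof.
move=> /basis_indexP[h0 h1 h2 h3 h4]; rewrite /b_minus /bM /qc.
have -> : n - 1 + (n - 1) + 2 = 2 * n by lia.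
have -> : n - 1 + (n - 1) + 4 = 2 * n + 2 by lia.
rewrite sqrtrM; last by rewrite exprz_ge0 // ltW // q0.
rewrite sqrt_qpq sqrtrM; last first.
  by rewrite mulr_ge0 // subr_ge0 qz_le1 //; lia.
rewrite sqrtrV; last by rewrite mulr_ge0 // subr_ge0 qz_le1 //; lia.
rewrite !sqrtrM ?subr_ge0 ?qz_le1 //; try lia.
by rewrite !qpD /qs; ring.
Qed.

End Coefficients.

(** * The defining relations, on coefficients *)

Section Relations.
Context {R : realType} {q : R} (hq : 0 < q < 1).
Implicit Types (n i j k : int).
Local Notation p := (Num.sqrt q).
Local Notation N := (@qp R q).
Local Notation Q := (@qs R q).
Local Notation c := (@qc R q).
Local Notation aP := (@aP R q).
Local Notation aM := (@aM R q).
Local Notation bP := (@bP R q).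
Local Notation bM := (@bM R q).

(* Arguments of qs and qc are put in the normal form t, so that equal factors
   become syntactically equal before the field tactic sees them. *)
Ltac norm_qs t := repeat match goal with |- context [@qs _ _ ?k] =>
  let EE := fresh in assert (EE : k = t) by (clear; lia); rewrite EE; clear EE end.
Ltac norm_qc t := repeat match goal with |- context [@qc _ _ ?k] =>
  let EE := fresh in assert (EE : k = t) by (clear; lia); rewrite EE; clear EE end.

Ltac norm_args n i j :=
  norm_qs (n - j); norm_qs (n - i); norm_qs (n + j); norm_qs (n + i);
  norm_qs (n - j + 2); norm_qs (n - i + 2); norm_qs (n + j + 2); norm_qs (n + i + 2);
  norm_qs (n - j + 4); norm_qs (n - i + 4); norm_qs (n + j + 4); norm_qs (n + i + 4);
  norm_qs (n - j - 2); norm_qs (n - i - 2); norm_qs (n + j - 2); norm_qs (n + i - 2);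
  norm_qc n; norm_qc (n - 1); norm_qc (n + 1); norm_qc (n - 2).

Ltac shifts := rewrite ?(qpS hq, qpP hq).

Let pn0 : p != 0. Proof. by rewrite gt_eqF // (p0 hq). Qed.

(* Entries that change n by 2 are single products on both sides: no relation
   between the factors is needed. The variable r stands for q^(1/2), in terms
   of which all factors are rational. *)
Ltac monomial_entry n i j := rewrite /aP /aM /bP /bM; shifts; norm_args n i j;
  move: (pp hq) pn0; move: p => r <- ?; field; done.

(** The five relations alpha' alpha + beta' beta = 1,
    alpha alpha' + q^2 beta beta' = 1, beta beta' + alpha' alpha = 1,
    alpha beta = q beta alpha and alpha beta' = q beta' alpha have three entries
    each, which change n by 2, by -2 and by 0: the suffixes up, down, diag. *)
Lemma unit_left_up n i j :
  aM (n + 1 + 1) (i - 1 + 1) (j - 1 + 1) * aP n i j +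
  bM (n + 1 + 1) (i + 1 - 1) (j - 1 + 1) * bP n i j = 0.
Proof. monomial_entry n i j. Qed.

Lemma unit_left_down n i j :
  aP (n - 1 - 1) (i - 1 + 1) (j - 1 + 1) * aM n i j +
  bP (n - 1 - 1) (i + 1 - 1) (j - 1 + 1) * bM n i j = 0.
Proof. monomial_entry n i j. Qed.

Lemma unit_right_up n i j :
  aP (n + 1) (i + 1) (j + 1) * aM (n + 1) (i + 1) (j + 1) +
  q ^+ 2 * (bP (n + 1) (i - 1) (j + 1) * bM (n + 1) (i - 1) (j + 1)) = 0.
Proof. monomial_entry n i j. Qed.

Lemma unit_right_down n i j :
  aM (n - 1) (i + 1) (j + 1) * aP (n - 1) (i + 1) (j + 1) +
  q ^+ 2 * (bM (n - 1) (i - 1) (j + 1) * bP (n - 1) (i - 1) (j + 1)) = 0.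
Proof. monomial_entry n i j. Qed.

Lemma qcomm_alpha_beta_up n i j :
  aP (n + 1) (i + 1) (j - 1) * bP n i j -
  q * (bP (n + 1) (i - 1) (j - 1) * aP n i j) = 0.
Proof. monomial_entry n i j. Qed.

Lemma qcomm_alpha_beta_down n i j :
  aM (n - 1) (i + 1) (j - 1) * bM n i j -
  q * (bM (n - 1) (i - 1) (j - 1) * aM n i j) = 0.
Proof. monomial_entry n i j. Qed.

Lemma qcomm_alpha_betas_up n i j :
  aP (n + 1) (i - 1) (j + 1) * bM (n + 1) (i - 1) (j + 1) -
  q * (bM (n + 1 + 1) (i - 1 - 1) (j - 1 + 1) * aP n i j) = 0.
Proof. monomial_entry n i j. Qed.

Lemma qcomm_alpha_betas_down n i j :
  aM (n - 1) (i - 1) (j + 1) * bP (n - 1) (i - 1) (j + 1) -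
  q * (bP (n - 1 - 1) (i - 1 - 1) (j - 1 + 1) * aM n i j) = 0.
Proof. monomial_entry n i j. Qed.

Lemma unit_mixed_up n i j :
  bP (n + 1) (i - 1) (j + 1) * bM (n + 1) (i - 1) (j + 1) +
  aM (n + 1 + 1) (i - 1 + 1) (j - 1 + 1) * aP n i j = 0.
Proof. monomial_entry n i j. Qed.

Lemma unit_mixed_down n i j :
  bM (n - 1) (i - 1) (j + 1) * bP (n - 1) (i - 1) (j + 1) +
  aP (n - 1 - 1) (i - 1 + 1) (j - 1 + 1) * aM n i j = 0.
Proof. monomial_entry n i j. Qed.

Lemma qc_prevM n : 0 < n ->
  c (n - 1) * c (n - 1) = ((1 - (N n * N n) ^+ 2) * (1 - (N n * N n * q) ^+ 2))^-1.
Proof.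
move=> n0; rewrite (qcM hq); last by lia.
congr ((_ * _)^-1); congr (1 - _ ^+ 2); rewrite (qpP hq);
  by move: (pp hq) pn0; move: p => r <- ?; field; done.
Qed.

Lemma qp_sq_lt1 n : 0 < n -> 1 - (N n * N n) ^+ 2 != 0.
Proof.
move=> n0; rewrite subr_eq0 eq_sym lt_eqF // -(qpq hq) expr_lt1 ?(qz_lt1 hq) //.
by rewrite exprz_ge0 // ltW // (q0 hq).
Qed.

(** At n = 0 the formula for the square of qc (n - 1) divides by zero. Then
    i = j = 0, and the terms that contain qc (n - 1) vanish. *)
Lemma zero_index_cases n i j : basis_index (n, i, j) ->
  (0 < n \/ [/\ [/\ N n = 1, N i = 1 & N j = 1], Q (n + i) = 0, Q (n + j) = 0 & c (n - 1) = 0]).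
Proof.
move=> /basis_indexP[h0 h1 h2 h3 h4].
have [n0|n0] := ltP 0 n; [by left|right].
have -> : n = 0 by lia. have -> : i = 0 by lia. have -> : j = 0 by lia.
by rewrite qp0 sub0r add0r qcN1 qs0.
Qed.

Lemma qp_q_sq_neq1 n : 0 <= n -> 1 - (N n * N n * q) ^+ 2 != 0.
Proof.
move=> n0; have -> : N n * N n * q = N (n + 1) * N (n + 1).
  by rewrite (qpS hq); move: (pp hq); move: p => r <-; ring.
by apply: qp_sq_lt1; lia.
Qed.

Lemma qp_qq_sq_neq1 n : 0 <= n -> 1 - (N n * N n * q * q) ^+ 2 != 0.
Proof.
move=> n0; have -> : N n * N n * q * q = N (n + 1 + 1) * N (n + 1 + 1).
  by rewrite !(qpS hq); move: (pp hq); move: p => r <-; ring.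
by apply: qp_sq_lt1; lia.
Qed.

Lemma qsM_basis n i j : basis_index (n, i, j) ->
  ((Q (n - j) * Q (n - j) = 1 - (N n / N j) ^+ 2) *
   (Q (n - i) * Q (n - i) = 1 - (N n / N i) ^+ 2) *
   (Q (n + j) * Q (n + j) = 1 - (N n * N j) ^+ 2) *
   (Q (n + i) * Q (n + i) = 1 - (N n * N i) ^+ 2)) *
  ((Q (n - j + 2) * Q (n - j + 2) = 1 - (N n / N j * q) ^+ 2) *
   (Q (n - i + 2) * Q (n - i + 2) = 1 - (N n / N i * q) ^+ 2) *
   (Q (n + j + 2) * Q (n + j + 2) = 1 - (N n * N j * q) ^+ 2) *
   (Q (n + i + 2) * Q (n + i + 2) = 1 - (N n * N i * q) ^+ 2)).
Proof.
move=> /basis_indexP[h0 h1 h2 h3 h4].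
by do ![split]; (rewrite (qsM hq); last by lia);
  rewrite -expr2 ?(qpD hq _ 2) ?(qp2 hq) (qpD hq) ?qpN.
Qed.

(* In a diagonal entry every factor qs k and qc k occurs squared, up to a
   common factor, and squares are rational in qp n, qp i, qp j and q. *)
Ltac diagonal_entry h i j :=
  let h0 := fresh in let n0 := fresh in let Nn := fresh in let Ni := fresh in
  let Nj := fresh in let Qi0 := fresh in let Qj0 := fresh in let c0 := fresh in
  let d1 := fresh in let d2 := fresh in
  let d3 := fresh in let d4 := fresh in let d5 := fresh in
  have [h0 _ _ _ _] := basis_indexP h;
  rewrite !(qsM_basis h) (qcM hq h0);
  move: (qp_q_sq_neq1 h0) (qp_qq_sq_neq1 h0);
  have [n0|[[Nn Ni Nj] Qi0 Qj0 c0]] := zero_index_cases h;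
  [ rewrite ?(qc_prevM n0); move: (qp_sq_lt1 n0) (qp_neq0 hq i) (qp_neq0 hq j);
    move=> d1 d2 d3 d4 d5; field; by rewrite ?d1 ?d2 ?d3 ?d4 ?d5
  | rewrite ?Qi0 ?Qj0 ?c0 ?mulr0 ?mul0r ?addr0 ?subr0 ?Nn ?Ni ?Nj !mul1r;
    move=> d1 d2 //; field; by rewrite ?d1 ?d2].

Lemma unit_left_diag n i j : basis_index (n, i, j) ->
  aP n i j ^+ 2 + aM n i j ^+ 2 + bP n i j ^+ 2 + bM n i j ^+ 2 = 1.
Proof.
move=> h.
(* the sum is regrouped to exhibit the squares of qs and qc *)
have -> : aP n i j ^+ 2 + aM n i j ^+ 2 + bP n i j ^+ 2 + bM n i j ^+ 2 =
  ((N n * N n * N i * N j * q) ^+ 2 * (Q (n - j + 2) * Q (n - j + 2)) *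
     (Q (n - i + 2) * Q (n - i + 2)) +
   (N n * N j) ^+ 2 * (Q (n - j + 2) * Q (n - j + 2)) *
     (Q (n + i + 2) * Q (n + i + 2))) * (c n * c n) +
  ((Q (n + j) * Q (n + j)) * (Q (n + i) * Q (n + i)) +
   (N n * N i) ^+ 2 * (Q (n + j) * Q (n + j)) * (Q (n - i) * Q (n - i))) *
    (c (n - 1) * c (n - 1)).
  by rewrite /aP /aM /bP /bM; ring.
diagonal_entry h i j.
Qed.

Lemma unit_right_diag n i j : basis_index (n, i, j) ->
  aP (n - 1) (i + 1) (j + 1) ^+ 2 + aM (n + 1) (i + 1) (j + 1) ^+ 2 +
  q ^+ 2 * (bP (n - 1) (i - 1) (j + 1) ^+ 2 + bM (n + 1) (i - 1) (j + 1) ^+ 2) = 1.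
Proof.
move=> h; rewrite /aP /aM /bP /bM; shifts; norm_args n i j.
transitivity (
  ((Q (n + j + 2) * Q (n + j + 2)) * (Q (n + i + 2) * Q (n + i + 2)) +
   q ^+ 2 * (N n * N i) ^+ 2 * (Q (n + j + 2) * Q (n + j + 2)) *
     (Q (n - i + 2) * Q (n - i + 2))) * (c n * c n) +
  ((N n * N n * N i * N j * q) ^+ 2 * (Q (n - j) * Q (n - j)) * (Q (n - i) * Q (n - i)) +
   q ^+ 2 * (N n * N j) ^+ 2 * (Q (n - j) * Q (n - j)) * (Q (n + i) * Q (n + i))) *
    (c (n - 1) * c (n - 1))).
  by move: (pp hq) pn0; move: p => r <- r0; field; rewrite ?r0.
diagonal_entry h i j.
Qed.

Lemma unit_mixed_diag n i j : basis_index (n, i, j) ->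
  bP (n - 1) (i - 1) (j + 1) ^+ 2 + bM (n + 1) (i - 1) (j + 1) ^+ 2 +
  (aP n i j ^+ 2 + aM n i j ^+ 2) = 1.
Proof.
move=> h; rewrite /aP /aM /bP /bM; shifts; norm_args n i j.
transitivity (
  ((N n * N i) ^+ 2 * (Q (n + j + 2) * Q (n + j + 2)) *
     (Q (n - i + 2) * Q (n - i + 2)) +
   (N n * N n * N i * N j * q) ^+ 2 * (Q (n - j + 2) * Q (n - j + 2)) *
     (Q (n - i + 2) * Q (n - i + 2))) * (c n * c n) +
  ((N n * N j) ^+ 2 * (Q (n - j) * Q (n - j)) * (Q (n + i) * Q (n + i)) +
   (Q (n + j) * Q (n + j)) * (Q (n + i) * Q (n + i))) *
    (c (n - 1) * c (n - 1))).
  by move: (pp hq) pn0; move: p => r <- r0; field; rewrite ?r0.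
diagonal_entry h i j.
Qed.

Lemma qcomm_alpha_beta_diag n i j : basis_index (n, i, j) ->
  aM (n + 1) (i + 1) (j - 1) * bP n i j + aP (n - 1) (i + 1) (j - 1) * bM n i j -
  q * (bM (n + 1) (i - 1) (j - 1) * aP n i j +
       bP (n - 1) (i - 1) (j - 1) * aM n i j) = 0.
Proof.
move=> h; rewrite /aP /aM /bP /bM; shifts; norm_args n i j.
transitivity (N n * N j * (Q (n - j + 2) * Q (n + j)) * (
  (- (Q (n + i + 2) * Q (n + i + 2)) -
   q ^+ 2 * (N n * N n) * (N i * N i) * (Q (n - i + 2) * Q (n - i + 2))) * (c n * c n) +
  (N n * N n * (N i * N i) * (Q (n - i) * Q (n - i)) +
   Q (n + i) * Q (n + i)) * (c (n - 1) * c (n - 1)))).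
  by move: (pp hq) pn0; move: p => r <- r0; field; rewrite ?r0.
diagonal_entry h i j.
Qed.

Lemma qcomm_alpha_betas_diag n i j : basis_index (n, i, j) ->
  aM (n + 1) (i - 1) (j + 1) * bM (n + 1) (i - 1) (j + 1) +
  aP (n - 1) (i - 1) (j + 1) * bP (n - 1) (i - 1) (j + 1) -
  q * (bP (n + 1 - 1) (i - 1 - 1) (j - 1 + 1) * aP n i j +
       bM (n - 1 + 1) (i - 1 - 1) (j - 1 + 1) * aM n i j) = 0.
Proof.
move=> h; rewrite /aP /aM /bP /bM; shifts; norm_args n i j.
transitivity (N n * N i * (Q (n - i + 2) * Q (n + i)) * (
  (Q (n + j + 2) * Q (n + j + 2) +
   q ^+ 2 * (N n * N n) * (N j * N j) * (Q (n - j + 2) * Q (n - j + 2))) * (c n * c n) +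
  (- (N n * N n * (N j * N j) * (Q (n - j) * Q (n - j))) -
   Q (n + j) * Q (n + j)) * (c (n - 1) * c (n - 1)))).
  by move: (pp hq) pn0; move: p => r <- r0; field; rewrite ?r0.
diagonal_entry h i j.
Qed.
End Relations.

(** * Bounds for the coefficients and for the commutators *)

Section Bounds.
Context {R : realType} {q : R} (hq : 0 < q < 1).
Implicit Types (n i j k : int).
Local Notation p := (Num.sqrt q).
Local Notation N := (@qp R q).
Local Notation Q := (@qs R q).
Local Notation c := (@qc R q).
Local Notation aP := (@aP R q).
Local Notation aM := (@aM R q).
Local Notation bP := (@bP R q).
Local Notation bM := (@bM R q).

Let norm_le1 (x y : R) : x ^+ 2 + y = 1 -> 0 <= y -> `|x| <= 1.
Proof.
move=> E y0; rewrite -(@expr_le1 _ 2) // real_normK ?num_real //; lra.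
Qed.

(** The four squares add up to 1, by alpha' alpha + beta' beta = 1. *)
Lemma coef_le1 n i j : basis_index (n, i, j) ->
  [/\ `|aP n i j| <= 1, `|aM n i j| <= 1, `|bP n i j| <= 1 & `|bM n i j| <= 1].
Proof.
move=> /(unit_left_diag hq) h.
have := (sqr_ge0 (aP n i j), sqr_ge0 (aM n i j), sqr_ge0 (bP n i j), sqr_ge0 (bM n i j)).
move=> [[[h1 h2] h3] h4].
split.
- by apply: (@norm_le1 _ (aM n i j ^+ 2 + bP n i j ^+ 2 + bM n i j ^+ 2)); lra.
- by apply: (@norm_le1 _ (aP n i j ^+ 2 + bP n i j ^+ 2 + bM n i j ^+ 2)); lra.
- by apply: (@norm_le1 _ (aP n i j ^+ 2 + aM n i j ^+ 2 + bM n i j ^+ 2)); lra.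
- by apply: (@norm_le1 _ (aP n i j ^+ 2 + aM n i j ^+ 2 + bP n i j ^+ 2)); lra.
Qed.

Lemma p_lt1 : p < 1.
Proof. by rewrite -(@expr_lt1 _ 2) ?sqrtr_ge0 // expr2 (pp hq) (q1 hq). Qed.

Lemma qp_linear_bound n : 0 <= n -> (n + n + 3)%:~R * N n <= 2 / (1 - p) + 3.
Proof.
case: n => // n _.
have p1 := p_lt1; have p0' := ltW (p0 hq).
(* m p^m is at most 1 + p + ... + p^(m-1), whose product with 1 - p is 1 - p^m *)
have H (m : nat) : m%:R * p ^+ m * (1 - p) <= 1 - p ^+ m.
  elim: m => [|m IH]; first by rewrite !mul0r subrr.
  have pm : p ^+ m <= 1 by rewrite exprn_ile1 // ltW.
  have pm0 : 0 <= p ^+ m by rewrite exprn_ge0.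
  have h1 := ler_wpM2l p0' IH.
  have h2 : 0 <= (1 - p) * (1 - p * p ^+ m).
    by rewrite mulr_ge0 ?subr_ge0 ?(ltW p1) // mulr_ile1 // ltW.
  rewrite exprS -natr1; move: h1 h2; move: (p ^+ m) => x; lra.
have h : n%:R * p ^+ n <= 1 / (1 - p).
  rewrite ler_pdivlMr ?subr_gt0 //; apply: le_trans (H n) _.
  by rewrite gerBl exprn_ge0.
have h1 : p ^+ n <= 1 by rewrite exprn_ile1 // ltW.
rewrite /qp -exprnP !intrD /= -pmulrn; lra.
Qed.

(** The 1 covers the entries with d(t) - d(s) = 1 or -1; the other summand
    bounds (2n + 3) q^(n/2) qc n. *)
Definition comm_bound : R := 1 + (2 / (1 - p) + 3) / (Q 2 * Q 2).

Let Q2 : 0 < Q 2. Proof. exact: qs_gt0. Qed.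

Lemma comm_bound_ge1 : 1 <= comm_bound.
Proof.
rewrite /comm_bound lerDl; apply: divr_ge0; last by rewrite mulr_ge0 // ltW.
by rewrite addr_ge0 // divr_ge0 // subr_ge0 ltW // p_lt1.
Qed.

Lemma qs_le1 k : 0 <= k -> Q k <= 1.
Proof.
move=> k0; rewrite -[X in _ <= X](sqrtr1) ler_wsqrtr // gerBl.
by rewrite exprz_ge0 // ltW // (q0 hq).
Qed.

Lemma qs_ge2 k : 2 <= k -> Q 2 <= Q k.
Proof.
move=> k2; rewrite ler_wsqrtr // lerD2l lerN2.
have -> : k = 2 + (k - 2) by lia.
rewrite expfzDr ?gt_eqF ?(q0 hq) //; apply: ler_piMr.
  by rewrite exprz_ge0 // ltW // (q0 hq).
by apply: (qz_le1 hq); lia.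
Qed.

Lemma qc_le n : 0 <= n -> c n <= (Q 2 * Q 2)^-1.
Proof.
move=> n0; rewrite /qc lef_pV2 ?posrE ?mulr_gt0 ?(qs_gt0 hq) //; try lia.
by apply: ler_pM; rewrite ?(ltW Q2) // qs_ge2 //; lia.
Qed.

Lemma qc_ge0 n : 0 <= c n.
Proof. by rewrite invr_ge0 mulr_ge0 // qs_ge0. Qed.

Let edge_bound n (x : R) : 0 <= n -> 0 <= x -> x <= N n * c n ->
  `|x * (n + n + 3)%:~R| <= comm_bound.
Proof.
move=> n0 x0 xN.
have m0 : 0 <= (n + n + 3)%:~R :> R by rewrite ler0z; lia.
rewrite ger0_norm; last exact: mulr_ge0.
apply: le_trans (ler_wpM2r m0 xN) _.
rewrite mulrAC [N n * _]mulrC.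
apply: (@le_trans _ _ ((2 / (1 - p) + 3) / (Q 2 * Q 2))); last by rewrite lerDr.
apply: ler_pM; [|exact: qc_ge0|exact: qp_linear_bound|exact: qc_le].
by rewrite mulr_ge0 // ltW // (qp_gt0 hq).
Qed.

Local Notation d := (@dirac_eigenvalue R).

Let near_bound (x y : R) : `|x| <= 1 -> `|y| = 1 -> `|x * y| <= comm_bound.
Proof.
by move=> x1 y1; rewrite normrM y1 mulr1 (le_trans x1) // comm_bound_ge1.
Qed.

(** If i = n the eigenvalue jumps from - (n + 1) to n + 2, and a_+ contains
    q^(n/2). *)
Lemma comm_aP n i j : basis_index (n, i, j) ->
  `|aP n i j * (d (n + 1) (i - 1) - d n i)| <= comm_bound.
Proof.
move=> h; have [h0 h1 h2 h3 h4] := basis_indexP h.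
rewrite /dirac_eigenvalue (_ : (n + 1 == i - 1) = false); last by lia.
case: eqP => [E|_]; last first.
  apply: near_bound; first by have [] := coef_le1 h.
  by rewrite -intrB (_ : _ - _ = 1) ?normr1 //; lia.
rewrite opprK -intrD (_ : n + 1 + 1 + (n + 1) = n + n + 3); last by lia.
apply: edge_bound => //; rewrite -E /aP.
  by rewrite !mulr_ge0 ?qs_ge0 ?qc_ge0 // ?ltW ?(qp_gt0 hq) ?(q0 hq).
rewrite subrr add0r; apply: ler_wpM2r; first exact: qc_ge0.
have -> : N n * N n * N n * N j * q * Q (n - j + 2) * Q 2 =
    N n * (N n * N (n + j) * q * Q (n - j + 2) * Q 2) by rewrite (qpD hq); ring.
apply: ler_piMr; first by rewrite ltW // (qp_gt0 hq).
have Nn1 := qp_le1 hq h0; have Nj1 := qp_le1 hq h4.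
have n2 : 0 <= n - j + 2 by lia.
have Nn0 := ltW (qp_gt0 hq n); have Nj0 := ltW (qp_gt0 hq (n + j)).
have q0' := ltW (q0 hq); have q1' := ltW (q1 hq).
by do !apply: mulr_ile1; rewrite ?mulr_ge0 ?qs_ge0 ?qs_le1.
Qed.

Lemma comm_aM n i j : basis_index (n, i, j) ->
  `|aM n i j * (d (n - 1) (i - 1) - d n i)| <= comm_bound.
Proof.
move=> h; apply: near_bound; first by have [] := coef_le1 h.
rewrite /dirac_eigenvalue (_ : (n - 1 == i - 1) = (n == i)); last by lia.
case: eqP => _; last first.
  by rewrite -intrB (_ : _ - _ = -1) ?normrN ?normr1 //; lia.
by rewrite opprK -intrN -intrD (_ : _ + _ = 1) ?normr1 //; lia.
Qed.

Lemma comm_bP n i j : basis_index (n, i, j) ->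
  `|bP n i j * (d (n + 1) (i + 1) - d n i)| <= comm_bound.
Proof.
move=> h; apply: near_bound; first by have [] := coef_le1 h.
rewrite /dirac_eigenvalue (_ : (n + 1 == i + 1) = (n == i)); last by lia.
case: eqP => _; last first.
  by rewrite -intrB (_ : _ - _ = 1) ?normr1 //; lia.
by rewrite opprK -intrN -intrD (_ : _ + _ = -1) ?normrN ?normr1 //; lia.
Qed.

(** If i = n - 2 the eigenvalue jumps from n + 1 to - n, and b_- contains
    q^((n-1)/2). *)
Lemma comm_bM n i j : basis_index (n, i, j) -> basis_index (n - 1, i + 1, j - 1) ->
  `|bM n i j * (d (n - 1) (i + 1) - d n i)| <= comm_bound.
Proof.
move=> h h'; have [h0 h1 h2 h3 h4] := basis_indexP h.
have [h0' h1' _ _ _] := basis_indexP h'.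
rewrite /dirac_eigenvalue (_ : (n == i) = false); last by lia.
case: eqP => [E|_]; last first.
  apply: near_bound; first by have [] := coef_le1 h.
  by rewrite -intrB (_ : _ - _ = -1) ?normrN ?normr1 //; lia.
rewrite -opprD -intrD mulrN normrN.
rewrite (_ : n - 1 + 1 + (n + 1) = n - 1 + (n - 1) + 3); last by lia.
have -> : i = n - 1 - 1 by lia.
apply: edge_bound => //; rewrite /bM.
  by rewrite !mulr_ge0 ?qs_ge0 ?qc_ge0 // ?ltW ?(qp_gt0 hq) ?(q0 hq).
rewrite (_ : n - (n - 1 - 1) = 2); last by lia.
apply: ler_wpM2r; first exact: qc_ge0.
have -> : N n * N (n - 1 - 1) * Q (n + j) * Q 2 =
    N (n - 1) * (N (n - 1) * Q (n + j) * Q 2).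
  by rewrite !(qpP hq); field; rewrite gt_eqF // (p0 hq).
apply: ler_piMr; first by rewrite ltW // (qp_gt0 hq).
have Nn1 := qp_le1 hq h0'; have Nn0 := ltW (qp_gt0 hq (n - 1)).
by do !apply: mulr_ile1; rewrite ?mulr_ge0 ?qs_ge0 ?qs_le1.
Qed.
End Bounds.

(** * The class of a matrix in K_1 *)

Section KTheory.
Context {R : realType} {H : completeNormedModType R[i]}.
Implicit Types (A : set (H -> H)) (a b c d : H -> H).

Lemma sub_norm_closure A : A `<=` norm_closure A.
Proof.
move=> a Aa eps eps0; exists a => // x.
by rewrite subrr normr0 mulr_ge0 // ltW.
Qed.

Lemma opmx_pad_id k (g : opmx H k) : opmx_pad k g = g.
Proof. by apply/matrixP => i j; rewrite mxE !valK. Qed.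

Lemma GL_homotopic_refl A k (g : opmx H k) : GL A g -> GL_homotopic A g g.
Proof.
move=> gA; exists (fun=> g); split=> // t _ eps eps0; exists 1 => // s _ _ i j x.
by rewrite subrr normr0 mulr_ge0 // ltW.
Qed.

Lemma K1_class_self A k (g : opmx H k) : GL A g ->
  K1_class A (existT _ k g) (existT _ k g).
Proof.
by move=> gA; split=> //; exists k; rewrite /= ?leqnn // opmx_pad_id; exact: GL_homotopic_refl.
Qed.

Definition opmx2 a b c d : opmx H 2 :=
  \matrix_(i, j) if i == 0 then if j == 0 then a else b else if j == 0 then c else d.

Lemma opmx2_over A a b c d : A a -> A b -> A c -> A d -> opmx_over A (opmx2 a b c d).
Proof. by move=> ? ? ? ? i j; rewrite mxE; do 2 case: ifP. Qed.

Lemma opmx2_mul a b c d a' b' c' d' :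
  opmx_mul (opmx2 a b c d) (opmx2 a' b' c' d') =
  opmx2 (fun x => a (a' x) + b (c' x)) (fun x => a (b' x) + b (d' x))
        (fun x => c (a' x) + d (c' x)) (fun x => c (b' x) + d (d' x)).
Proof.
apply/matrixP => i j; rewrite !mxE; apply/funext => x.
rewrite big_ord_recl big_ord1 !mxE /=.
by case: (i == 0); case: (j == 0).
Qed.

Lemma opmx2_1 : opmx1 H 2 = opmx2 id (fun=> 0) (fun=> 0) id.
Proof.
apply/matrixP => i j; rewrite !mxE; apply/funext => x.
by case: i j => [[|[|?]] ?] [[|[|?]] ?].
Qed.
End KTheory.

(** * The relations of SU_q(2) and the fundamental unitary *)

Section Combine.
Context {R : realType} {V : lmodType R[i]}.
Local Notation "x %:C" := (real_complex R x).

(** The shape of a b + k c d = m on a basis vector, when each of a, b, c, d has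
    a raising and a lowering term: v, u, w are the vectors at levels n + 2, n
    and n - 2, and x, y (z, t) are the coefficients of the inner operator. *)
Lemma combine_two_terms (u v w : V) (x x1 x2 y y1 y2 k z z1 z2 t t1 t2 m : R) :
  x1 * x + k * (z1 * z) = 0 ->
  x2 * x + y1 * y + k * (z2 * z + t1 * t) = m ->
  y2 * y + k * (t2 * t) = 0 ->
  (x%:C *: (x1%:C *: v + x2%:C *: u) + y%:C *: (y1%:C *: u + y2%:C *: w)) +
  k%:C *: (z%:C *: (z1%:C *: v + z2%:C *: u) + t%:C *: (t1%:C *: u + t2%:C *: w)) =
  m%:C *: u.
Proof.
move=> h1 h2 h3.
transitivity ((x1 * x + k * (z1 * z))%:C *: v +
  (x2 * x + y1 * y + k * (z2 * z + t1 * t))%:C *: u +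
  (y2 * y + k * (t2 * t))%:C *: w); last first.
  by rewrite h1 h2 h3 !scale0r add0r addr0.
rewrite !scalerDr !scalerA !rmorphD !rmorphM /= rmorphD !rmorphM /=.
rewrite !scalerDl !mulrDr !scalerDl.
rewrite ![x%:C * _]mulrC ![y%:C * _]mulrC.
rewrite ![_ * z%:C * _]mulrAC ![_ * t%:C * _]mulrAC !mulrA.
set a1 := _ *: v; set a2 := _ *: u; set a3 := _ *: u; set a4 := _ *: w.
set b1 := _ *: v; set b2 := _ *: u; set b3 := _ *: u; set b4 := _ *: w.
rewrite [LHS]addrACA [a1 + a2 + _]addrACA [a3 + a4 + _]addrACA.
by rewrite [a2 + a3 + _]addrACA !addrA.
Qed.
End Combine.

Section Operators.
Context {R : realType} {q : R} (hq : 0 < q < 1).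
Context {H : completeNormedModType R[i]} {dot : {dot H for Num.conj}}.
Context (hdot : hilbert_norm dot) {e : int * int * int -> H}.
Context (he : orthonormal_basis dot basis_index e).
Context {alpha beta : H -> H} (halpha : bounded_op alpha) (hbeta : bounded_op beta).
Context (ealpha : alpha_action q e alpha) (ebeta : beta_action q e beta).
Implicit Types (n i j k : int).
Local Notation "x %:C" := (real_complex R x).
Local Notation aP := (@aP R q).
Local Notation aM := (@aM R q).
Local Notation bP := (@bP R q).
Local Notation bM := (@bM R q).

Let e_out n i j : ~~ basis_index (n, i, j) -> e (n, i, j) = 0.
Proof. exact: basis_out he _. Qed.

(** The formula also holds outside of the index set, where both sides are zero:
    if e_(n+1, i-1, j-1) is a basis vector but e_(n,i,j) is not, then i or j is
    n + 2 and a_+ vanishes. This allows to compose without case distinctions. *)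
Lemma alphaE n i j : alpha (e (n, i, j)) =
  (aP n i j)%:C *: e (n + 1, i - 1, j - 1) + (aM n i j)%:C *: e (n - 1, i - 1, j - 1).
Proof.
have [h|h] := boolP (basis_index (n, i, j)).
  by rewrite ealpha // a_plusE // a_minusE.
rewrite e_out // (bounded_op0 halpha).
have [h1|/e_out ->] := boolP (basis_index (n + 1, i - 1, j - 1)); last first.
  rewrite scaler0 add0r [X in _ *: X]e_out ?scaler0 //.
  by apply: contra h => /and4P[? ? ? ?]; apply/and4P; split; lia.
rewrite [X in _ + _ *: X]e_out ?scaler0 ?addr0; last first.
  by apply: contra h => /and4P[? ? ? ?]; apply/and4P; split; lia.
suff -> : aP n i j = 0 by rewrite scale0r.
have : (n - j + 2 == 0) || (n - i + 2 == 0).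
  apply: contraR h; rewrite negb_or => /andP[? ?].
  by move: h1 => /and4P[? ? ? ?]; apply/and4P; split; lia.
by rewrite /aP => /orP[]/eqP ->; rewrite qs0 ?mulr0 ?mul0r.
Qed.

Lemma betaE n i j : beta (e (n, i, j)) =
  (bP n i j)%:C *: e (n + 1, i + 1, j - 1) + (bM n i j)%:C *: e (n - 1, i + 1, j - 1).
Proof.
have [h|h] := boolP (basis_index (n, i, j)).
  by rewrite ebeta // b_plusE // b_minusE.
rewrite e_out // (bounded_op0 hbeta).
have [h1|/e_out ->] := boolP (basis_index (n + 1, i + 1, j - 1)); last first.
  rewrite scaler0 add0r [X in _ *: X]e_out ?scaler0 //.
  by apply: contra h => /and4P[? ? ? ?]; apply/and4P; split; lia.
rewrite [X in _ + _ *: X]e_out ?scaler0 ?addr0; last first.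
  by apply: contra h => /and4P[? ? ? ?]; apply/and4P; split; lia.
suff -> : bP n i j = 0 by rewrite scale0r.
have : (n - j + 2 == 0) || (n + i + 2 == 0).
  apply: contraR h; rewrite negb_or => /andP[? ?].
  by move: h1 => /and4P[? ? ? ?]; apply/and4P; split; lia.
by rewrite /bP => /orP[]/eqP ->; rewrite qs0 ?mulr0 ?mul0r ?oppr0.
Qed.

Local Notation I := (int * int * int)%type.
Let shiftK (d : I) : cancel (fun s : I => s + d) (fun s => s - d).
Proof. by move=> s; rewrite addrK. Qed.
Let shiftNK (d : I) : cancel (fun s : I => s - d) (fun s => s + d).
Proof. by move=> s; rewrite subrK. Qed.
Let fn (w : int -> int -> int -> R) (s : I) : R := w s.1.1 s.1.2 s.2.

Lemma alpha_adjoint : exists2 alphas, adjoint_pair dot alpha alphas &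
  forall n i j, alphas (e (n, i, j)) =
    (aM (n + 1) (i + 1) (j + 1))%:C *: e (n + 1, i + 1, j + 1) +
    (aP (n - 1) (i + 1) (j + 1))%:C *: e (n - 1, i + 1, j + 1).
Proof.
have [[[n i] j] h _|[[n i] j] h _|[[n i] j] h|b hb be] :=
  @two_terms_adjoint _ _ _ hdot _ _ _ he alpha
    (fun s => s + (1, -1, -1)) (fun s => s - (1, -1, -1))
    (fun s => s + (-1, -1, -1)) (fun s => s - (-1, -1, -1))
    (fn aP) (fn aM) 1 halpha (shiftK _) (shiftNK _) (shiftK _) (shiftNK _).
- by have [] := coef_le1 hq h.
- by have [] := coef_le1 hq h.
- exact: alphaE.
exists b => // n i j.
have [h|h] := boolP (basis_index (n, i, j)); first by rewrite be // addrC.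
rewrite e_out //; have [_ /bounded_op0 -> _] := hb.
rewrite [X in _ + _ *: X]e_out ?scaler0 ?addr0; last first.
  by apply: contra h => /and4P[? ? ? ?]; apply/and4P; split; lia.
have [h1|/e_out ->] := boolP (basis_index (n + 1, i + 1, j + 1)); last first.
  by rewrite scaler0.
suff -> : aM (n + 1) (i + 1) (j + 1) = 0 by rewrite scale0r.
have : (n + 1 + (j + 1) == 0) || (n + 1 + (i + 1) == 0).
  apply: contraR h; rewrite negb_or => /andP[? ?].
  by move: h1 => /and4P[? ? ? ?]; apply/and4P; split; lia.
by rewrite /aM => /orP[]/eqP ->; rewrite qs0 ?mulr0 ?mul0r.
Qed.

Lemma beta_adjoint : exists2 betas, adjoint_pair dot beta betas &
  forall n i j, betas (e (n, i, j)) =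
    (bM (n + 1) (i - 1) (j + 1))%:C *: e (n + 1, i - 1, j + 1) +
    (bP (n - 1) (i - 1) (j + 1))%:C *: e (n - 1, i - 1, j + 1).
Proof.
have [[[n i] j] h _|[[n i] j] h _|[[n i] j] h|b hb be] :=
  @two_terms_adjoint _ _ _ hdot _ _ _ he beta
    (fun s => s + (1, 1, -1)) (fun s => s - (1, 1, -1))
    (fun s => s + (-1, 1, -1)) (fun s => s - (-1, 1, -1))
    (fn bP) (fn bM) 1 hbeta (shiftK _) (shiftNK _) (shiftK _) (shiftNK _).
- by have [] := coef_le1 hq h.
- by have [] := coef_le1 hq h.
- exact: betaE.
exists b => // n i j.
have [h|h] := boolP (basis_index (n, i, j)); first by rewrite be // addrC.
rewrite e_out //; have [_ /bounded_op0 -> _] := hb.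
rewrite [X in _ + _ *: X]e_out ?scaler0 ?addr0; last first.
  by apply: contra h => /and4P[? ? ? ?]; apply/and4P; split; lia.
have [h1|/e_out ->] := boolP (basis_index (n + 1, i - 1, j + 1)); last first.
  by rewrite scaler0.
suff -> : bM (n + 1) (i - 1) (j + 1) = 0 by rewrite scale0r.
have : (n + 1 + (j + 1) == 0) || (n + 1 - (i - 1) == 0).
  apply: contraR h; rewrite negb_or => /andP[? ?].
  by move: h1 => /and4P[? ? ? ?]; apply/and4P; split; lia.
by rewrite /bM => /orP[]/eqP ->; rewrite qs0 ?mulr0 ?mul0r.
Qed.

Context {alphas betas : H -> H}.
Context (aa : adjoint_pair dot alpha alphas) (bb : adjoint_pair dot beta betas).
Context (alphasE : forall n i j, alphas (e (n, i, j)) =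
    (aM (n + 1) (i + 1) (j + 1))%:C *: e (n + 1, i + 1, j + 1) +
    (aP (n - 1) (i + 1) (j + 1))%:C *: e (n - 1, i + 1, j + 1)).
Context (betasE : forall n i j, betas (e (n, i, j)) =
    (bM (n + 1) (i - 1) (j + 1))%:C *: e (n + 1, i - 1, j + 1) +
    (bP (n - 1) (i - 1) (j + 1))%:C *: e (n - 1, i - 1, j + 1)).
Let halphas : bounded_op alphas. Proof. by have [] := aa. Qed.
Let hbetas : bounded_op betas. Proof. by have [] := bb. Qed.

Let relation (a b c d : H -> H) (k m : R) :
  bounded_op a -> bounded_op b -> bounded_op c -> bounded_op d ->
  (forall n i j, basis_index (n, i, j) ->
     a (b (e (n, i, j))) + k%:C *: c (d (e (n, i, j))) = m%:C *: e (n, i, j)) ->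
  forall x, a (b x) + k%:C *: c (d x) = m%:C *: x.
Proof.
move=> ha hb hc hd h x.
suff /(congr1 (@^~ x)) : (fun x => a (b x) + k%:C *: c (d x)) = (fun x => m%:C *: x) by [].
apply: (bounded_op_eq he) => [||[[n i] j]]; last exact: h.
  apply: bounded_op_add; first exact: bounded_op_comp.
  by apply: bounded_op_scale; exact: bounded_op_comp.
exact/bounded_op_scale/bounded_op_id.
Qed.

Lemma suq2_unit_left x : alphas (alpha x) + betas (beta x) = x.
Proof.
rewrite -[X in _ + X]scale1r -[RHS]scale1r.
apply: (@relation alphas alpha betas beta 1 1) => // n i j h.
rewrite alphaE betaE (bounded_opD halphas) (bounded_opD hbetas).
rewrite !(bounded_opZ halphas) !(bounded_opZ hbetas) !alphasE !betasE.
rewrite ?addrK ?subrK.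
apply: combine_two_terms; rewrite ?mul1r.
- by have := unit_left_up hq n i j; rewrite ?addrK ?subrK.
- have := unit_left_diag hq h; rewrite !expr2 => <-; ring.
- by have := unit_left_down hq n i j; rewrite ?addrK ?subrK.
Qed.

Lemma suq2_unit_right x : alpha (alphas x) + (q ^+ 2)%:C *: beta (betas x) = x.
Proof.
rewrite -[RHS]scale1r.
apply: (@relation alpha alphas beta betas (q ^+ 2) 1) => // n i j h.
rewrite alphasE betasE (bounded_opD halpha) (bounded_opD hbeta).
rewrite !(bounded_opZ halpha) !(bounded_opZ hbeta) !alphaE !betaE.
rewrite ?addrK ?subrK.
apply: combine_two_terms.
- exact: unit_right_up.
- have := unit_right_diag hq h; rewrite !expr2 => <-; ring.
- exact: unit_right_down.
Qed.

Lemma suq2_unit_mixed x : beta (betas x) + alphas (alpha x) = x.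
Proof.
rewrite -[X in _ + X]scale1r -[RHS]scale1r.
apply: (@relation beta betas alphas alpha 1 1) => // n i j h.
rewrite alphaE betasE (bounded_opD halphas) (bounded_opD hbeta).
rewrite !(bounded_opZ halphas) !(bounded_opZ hbeta) !alphasE !betaE.
rewrite ?addrK ?subrK.
apply: combine_two_terms; rewrite ?mul1r.
- by have := unit_mixed_up hq n i j; rewrite ?addrK ?subrK.
- have := unit_mixed_diag hq h; rewrite !expr2 => <-; ring.
- by have := unit_mixed_down hq n i j; rewrite ?addrK ?subrK.
Qed.

Lemma suq2_normal x : betas (beta x) = beta (betas x).
Proof.
by apply: (@addrI _ (alphas (alpha x))); rewrite suq2_unit_left addrC suq2_unit_mixed.
Qed.

Lemma suq2_alpha_beta x : alpha (beta x) = q%:C *: beta (alpha x).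
Proof.
apply/eqP; rewrite -subr_eq0 -scaleNr -rmorphN; apply/eqP.
rewrite -[RHS](scale0r x); apply: (@relation alpha beta beta alpha (- q) 0) => // n i j h.
rewrite alphaE betaE (bounded_opD halpha) (bounded_opD hbeta).
rewrite !(bounded_opZ halpha) !(bounded_opZ hbeta) !alphaE !betaE.
rewrite ?addrK ?subrK.
transitivity (0%:C *: e (n, i, j - 1 - 1)); last by rewrite !scale0r.
apply: combine_two_terms; rewrite mulNr.
- exact: qcomm_alpha_beta_up.
- exact: qcomm_alpha_beta_diag.
- exact: qcomm_alpha_beta_down.
Qed.

Lemma suq2_alpha_betas x : alpha (betas x) = q%:C *: betas (alpha x).
Proof.
apply/eqP; rewrite -subr_eq0 -scaleNr -rmorphN; apply/eqP.
rewrite -[RHS](scale0r x); apply: (@relation alpha betas betas alpha (- q) 0) => // n i j h.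
rewrite alphaE betasE (bounded_opD halpha) (bounded_opD hbetas).
rewrite !(bounded_opZ halpha) !(bounded_opZ hbetas) !alphaE !betasE.
rewrite ?addrK ?subrK.
transitivity (0%:C *: e (n, i - 1 - 1, j)); last by rewrite !scale0r.
apply: combine_two_terms; rewrite mulNr.
- by have := qcomm_alpha_betas_up hq n i j; rewrite ?addrK ?subrK.
- by have := qcomm_alpha_betas_diag hq h; rewrite ?addrK ?subrK.
- by have := qcomm_alpha_betas_down hq n i j; rewrite ?addrK ?subrK.
Qed.

Let adjoint_relation a b a' b' : adjoint_pair dot a a' -> adjoint_pair dot b b' ->
  (forall x, a (b x) = q%:C *: b (a x)) -> forall x, b' (a' x) = q%:C *: a' (b' x).
Proof.
move=> [_ _ ha] [_ _ hb] h x; apply: (@dot_inj _ _ dot) => z.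
rewrite (adjoint_sym hb) (adjoint_sym ha) h dotZr conj_realC dotZl.
by rewrite (adjoint_sym ha) (adjoint_sym hb).
Qed.

Lemma suq2_betas_alphas x : betas (alphas x) = q%:C *: alphas (betas x).
Proof. exact: adjoint_relation aa bb suq2_alpha_beta x. Qed.

Lemma suq2_beta_alphas x : beta (alphas x) = q%:C *: alphas (beta x).
Proof. exact: adjoint_relation aa (adjoint_pair_sym bb) suq2_alpha_betas x. Qed.

(** The matrix is unitary: its inverse is ((alpha', beta'), (- q beta, alpha)). *)
Lemma fundamental_GL : GL (norm_closure (star_algebra dot [set alpha; beta]))
    (opmx2 alpha (fun x => (- q)%:C *: betas x) beta alphas).
Proof.
set A := star_algebra _ _.
have Aalpha : A alpha by apply: star_gen; left.
have Abeta : A beta by apply: star_gen; right.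
have Aalphas : A alphas by have [_ _ h] := aa; exact: star_adj h.
have Abetas : A betas by have [_ _ h] := bb; exact: star_adj h.
split.
  by apply: opmx2_over; apply: sub_norm_closure => //; exact: star_scale.
exists (opmx2 alphas betas (fun x => (- q)%:C *: beta x) alpha); split.
- by apply: opmx2_over; apply: sub_norm_closure => //; exact: star_scale.
- rewrite opmx2_mul opmx2_1; congr opmx2; apply/funext => x.
  + rewrite (bounded_opZ hbetas) scalerA -rmorphM mulrNN -expr2 suq2_normal.
    exact: suq2_unit_right.
  + by rewrite suq2_alpha_betas rmorphN scaleNr subrr.
  + by rewrite (bounded_opZ halphas) suq2_beta_alphas rmorphN scaleNr subrr.
  + exact: suq2_unit_mixed.
- rewrite opmx2_mul opmx2_1; congr opmx2; apply/funext => x.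
  + exact: suq2_unit_left.
  + by rewrite (bounded_opZ halphas) suq2_betas_alphas rmorphN scaleNr addNr.
  + by rewrite suq2_alpha_beta rmorphN scaleNr addNr.
  + rewrite (bounded_opZ hbeta) !scalerA -!rmorphM mulrNN -expr2 addrC.
    exact: suq2_unit_right.
Qed.

End Operators.

(** * The operator D *)

Section Dirac.
Context {R : realType} {H : completeNormedModType R[i]} {dot : {dot H for Num.conj}}.
Context (hdot : hilbert_norm dot) {e : int * int * int -> H}.
Context (he : orthonormal_basis dot basis_index e).
Implicit Types (n i j : int) (s : int * int * int).
Local Notation "x %:C" := (real_complex R x).
Local Notation D := (dirac_op dot e).

Definition dirac_ev s : R := dirac_eigenvalue R s.1.1 s.1.2.

Lemma dirac_ev_ge s : basis_index s -> s.1.1%:~R + 1 <= `|dirac_ev s|.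
Proof.
case: s => [[n i] j] /basis_indexP[h _ _ _ _].
have n0 : 0 <= n%:~R :> R by rewrite ler0z.
by rewrite /dirac_ev /dirac_eigenvalue /=; 
  case: ifP => _; rewrite ?normrN intrD ger0_norm // addr_ge0.
Qed.

Lemma dirac_ev_ge1 s : basis_index s -> 1 <= `|dirac_ev s|.
Proof.
move=> h; apply: le_trans (dirac_ev_ge h); rewrite lerDr ler0z.
by case: s h => [[n i] j] /basis_indexP[].
Qed.

Lemma dirac_ev_neq0 s : basis_index s -> dirac_ev s != 0.
Proof. by move/dirac_ev_ge1 => h; rewrite -normr_gt0 (lt_le_trans _ h). Qed.

Lemma dirac_sg s : basis_index s -> Num.sg (dirac_ev s) = if s.1.1 == s.1.2 then -1 else 1.
Proof.
case: s => [[n i] j] /basis_indexP[h _ _ _ _].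
rewrite /dirac_ev /dirac_eigenvalue /=.
have n1 : 0 < (n + 1)%:~R :> R by rewrite ltr0z; lia.
by case: ifP => _; rewrite ?sgrN gtr0_sg.
Qed.

Lemma dirac_opP x y : D x y <->
  forall s, basis_index s -> dot y (e s) = (dirac_ev s)%:C * dot x (e s).
Proof. by split=> [h [[n i] j]|h n i j]; exact: h. Qed.

Section Inverse.
Context {T : H -> H} (hT : adjoint_pair dot T T).
Context (Te : forall s, basis_index s -> T (e s) = ((dirac_ev s)^-1)%:C *: e s).

Lemma dirac_inverse x y : D x y <-> x = T y.
Proof.
rewrite dirac_opP; have dT := diagonal_dot hT Te.
split=> [h|-> s rs].
  apply: (dot_basis_inj hdot he) => s rs.
  rewrite dT // h // mulrA -rmorphM mulVf ?mul1r ?rmorph1 ?mul1r //.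
  exact: dirac_ev_neq0.
by rewrite dT // mulrA -rmorphM mulfV ?rmorph1 ?mul1r // dirac_ev_neq0.
Qed.

Lemma dirac_dense : closure (dom D) = setT.
Proof.
have [_ dense _] := he.
rewrite -subTset -[X in X `<=` _]dense; apply: closure_subset => _ [r [c [rr ->]]].
exists (\sum_(s <- r) (c s * (dirac_ev s)%:C) *: e s); apply/dirac_inverse.
have [Tb _ _] := hT; rewrite (bounded_op_sum _ _ Tb); apply: eq_big_seq => s sr.
have rs := allP rr _ sr.
rewrite (bounded_opZ Tb) Te // scalerA -mulrA -rmorphM mulfV ?rmorph1 ?mulr1 //.
exact: dirac_ev_neq0.
Qed.

Lemma dirac_inverse_compact : compact_op T.
Proof.
have [Tb _ _] := hT.
apply: (diagonal_compact hdot he Tb Te) => eps eps0.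
have [m mE] : exists m : nat, eps^-1 <= m%:R.
  by exists (Num.truncn eps^-1).+1; apply/ltW/truncnS_gt.
(* an eigenvalue of T above eps belongs to an index with n <= m, a finite set *)
pose L : seq int := [seq k%:Z - m%:Z | k <- iota 0 (m + m + 1)].
have inL (k : int) : `|k| <= m%:Z -> k \in L.
  move=> km; apply/mapP; exists (absz (k + m%:Z)); first by rewrite mem_iota; lia.
  by lia.
exists [seq (x, y) | x <- [seq (x, y) | x <- L, y <- L], y <- L] => s rs sL.
have mn : m%:Z < s.1.1.
  case: s rs sL => [[n i] j] /= /and4P[? ? ? ?]; apply: contraR; rewrite -leNgt => nm.
  apply: allpairs_f; last by apply: inL; lia.
  by apply: allpairs_f; apply: inL; lia.
rewrite normrV ?unitfE ?dirac_ev_neq0 // -[eps]invrK lef_pV2 ?posrE ?invr_gt0 //.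
  apply: le_trans mE _; apply: le_trans (dirac_ev_ge rs).
  by rewrite -[m%:R]/(m%:Z%:~R) ler_wpDr // ler_int ltW.
by rewrite normr_gt0 dirac_ev_neq0.
Qed.
End Inverse.

Lemma exists_dirac_inverse : exists2 T, adjoint_pair dot T T &
  forall s, basis_index s -> T (e s) = ((dirac_ev s)^-1)%:C *: e s.
Proof.
have [s rs|T [hT _ Te]] := @diagonal_pair _ _ _ hdot _ _ _ he (fun s => (dirac_ev s)^-1) 1.
  have := dirac_ev_ge1 rs; rewrite normrV ?unitfE ?dirac_ev_neq0 // => h.
  by rewrite invf_le1 // (lt_le_trans _ h).
by exists T.
Qed.

(** The sign of D is diagonal with sign -1 exactly on the e_(n,n,j): an
    eigenvector of D only has coefficients at indices of its own eigenvalue. *)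
Lemma exists_edge_projection : exists P, [/\ negative_projection dot D P,
  adjoint_pair dot P P & forall n i j, P (e (n, i, j)) = if n == i then e (n, i, j) else 0].
Proof.
have [s _|S [hS _ Se]] := @diagonal_pair _ _ _ hdot _ _ _ he
    (fun s => if s.1.1 == s.1.2 then -1 else 1) 1.
  by case: ifP; rewrite ?normrN normr1.
have [s _|P [hP _ Pe]] := @diagonal_pair _ _ _ hdot _ _ _ he
    (fun s => if s.1.1 == s.1.2 then 1 else 0) 1.
  by case: ifP; rewrite ?normr1 ?normr0.
have [Sb _ Sadj] := hS; have [Pb _ Padj] := hP.
have dS := diagonal_dot hS Se; have dP := diagonal_dot hP Pe.
have Pe' n i j : P (e (n, i, j)) = if n == i then e (n, i, j) else 0.
  have [/Pe ->|/(basis_out he) ->] := boolP (basis_index (n, i, j)).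
    by rewrite /=; case: ifP; rewrite ?scale1r ?scale0r.
  by rewrite (bounded_op0 Pb) if_same.
exists P; split=> //; exists S.
  split=> // lambda x /dirac_opP Dx; apply: (dot_basis_inj hdot he) => s rs.
  rewrite dS // dotZl.
  have [->|x0] := eqVneq (dot x (e s)) 0; first by rewrite !mulr0.
  have : lambda%:C * dot x (e s) = (dirac_ev s)%:C * dot x (e s).
    by rewrite -Dx // dotZl.
  by move/(mulIf x0)/complexI => ->; rewrite dirac_sg.
move=> x; split=> [|y /= Sy].
  apply: (dot_basis_inj hdot he) => s rs; rewrite dS // dotNl dP //=.
  by case: ifP => _; rewrite ?rmorphN ?rmorph1 ?mulN1r ?mul0r ?mulr0 ?oppr0.
rewrite dotBl Padj.
suff -> : P y = y by rewrite subrr.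
apply: (dot_basis_inj hdot he) => s rs; rewrite dP //.
have := dS y s rs; rewrite Sy dotNl; case: ifP => _; first by rewrite mul1r.
rewrite mul1r mul0r => /eqP; rewrite eq_sym -subr_eq0 opprK -mulr2n mulrn_eq0 /=.
by move/eqP.
Qed.
End Dirac.

(** * The compression of the fundamental unitary to the edge i = n *)

Lemma edge_zero (n j : int) : basis_index (n, n, j) -> 0 < n \/ n = 0 /\ j = 0.
Proof. by move=> /basis_indexP[h0 h1 h2 h3 h4]; lia. Qed.

Lemma edge_one (j : int) : basis_index (1, 1, j) -> j = 1 \/ j = -1.
Proof. by move=> /and4P[]; lia. Qed.

Section EdgeCoefficients.
Context {R : realType} {q : R} (hq : 0 < q < 1).
Implicit Types (n i j k : int).
Local Notation p := (Num.sqrt q).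
Local Notation N := (@qp R q).
Local Notation Q := (@qs R q).
Local Notation c := (@qc R q).

(** [ex] and [ey] are the coefficients of the compressions of alpha and beta to
    the edge, [eomega] the eigenvalues of W, the inverse of L. Division by zero
    gives eomega 0 = 0, as W f_00 = 0 demands. *)
Definition ex n j := @aM R q n n j.
Definition ey n j := @bP R q n n j.
Definition eomega n := (1 - (N n * N n * q) ^+ 2) / (1 - (N n * N n) ^+ 2).

Lemma exE n j : 0 < n -> ex n j = Q (n + j) / Q (n + n + 2).
Proof.
move=> n0; rewrite /ex /aM /qc.
rewrite (_ : n - 1 + (n - 1) + 2 = n + n); last by ring.
rewrite (_ : n - 1 + (n - 1) + 4 = n + n + 2); last by ring.
by field; rewrite !(qs_neq0 hq) //; lia.
Qed.

Lemma eyE n j : 0 <= n -> ey n j = - (N n * N j * Q (n - j + 2)) / Q (n + n + 4).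
Proof.
move=> n0; rewrite /ey /bP /qc; field.
by rewrite !(qs_neq0 hq) //; lia.
Qed.

Lemma eomegaS n : eomega (n + 1) =
  (1 - (N n * N n * q * q) ^+ 2) / (1 - (N n * N n * q) ^+ 2).
Proof.
rewrite /eomega !(qpS hq) (_ : N n * p * (N n * p) = N n * N n * q) //.
by move: (pp hq); move: p => r <-; ring.
Qed.

Lemma eomega_bound n : 0 <= n -> `|eomega n| <= (Q 2 * Q 2)^-1.
Proof.
move=> n0; have Q2 : 0 < Q 2 * Q 2 by rewrite mulr_gt0 ?(qs_gt0 hq).
have [->|n1] := eqVneq n 0.
  by rewrite /eomega qp0 mul1r expr1n subrr invr0 mulr0 normr0 invr_ge0 ltW.
have nn : 2 <= n + n by lia.
have E k : 0 <= k -> 1 - (N k * N k) ^+ 2 = Q (k + k) * Q (k + k).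
  by move=> k0; rewrite (qsM hq) ?addr_ge0 //= !(qpD hq) expr2.
have -> : eomega n = Q (n + 1 + (n + 1)) * Q (n + 1 + (n + 1)) *
    (Q (n + n) * Q (n + n))^-1.
  rewrite -!E //; last by lia.
  rewrite /eomega !(qpS hq) (_ : N n * Num.sqrt q * (N n * Num.sqrt q) = N n * N n * q) //.
  by move: (pp hq); move: (Num.sqrt q) => r <-; ring.
rewrite ger0_norm; last by rewrite !mulr_ge0 ?invr_ge0 ?mulr_ge0 ?qs_ge0.
apply: (@le_trans _ _ (1 * (Q (n + n) * Q (n + n))^-1)).
  apply: ler_wpM2r; first by rewrite invr_ge0 mulr_ge0 ?qs_ge0.
  have m0 : 0 <= n + 1 + (n + 1) by lia.
  by rewrite mulr_ile1 ?qs_ge0 ?(qs_le1 hq).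
rewrite mul1r lef_pV2 ?posrE //; last by rewrite mulr_gt0 ?(qs_gt0 hq) //; lia.
by apply: ler_pM; rewrite ?qs_ge0 ?(qs_ge2 hq).
Qed.

(** In [edge_ts01] and its variants, ts and st stand for T S and S T, and the
    digits for the row and the column of the entry. *)
Section AtIndex.
Variables (n j : int) (h : basis_index (n, n, j)).
Let n0 : 0 <= n. Proof. by have [] := basis_indexP h. Qed.

Let x0 : ex n j = Q (n + j) / Q (n + n + 2).
Proof.
have [/exE //|[-> ->]] := edge_zero h.
by rewrite /ex /aM addr0 qs0 !mul0r.
Qed.
Let x1 : ex (n + 1) (j + 1) = Q (n + j + 2) / Q (n + n + 4).
Proof.
rewrite exE; last by lia.
by congr (Q _ / Q _); lia.
Qed.
Let y0 : ey n j = - (N n * N j * Q (n - j + 2)) / Q (n + n + 4).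
Proof. exact: eyE. Qed.
Let y1 : ey (n - 1) (j + 1) = - (N n * N j * Q (n - j)) / Q (n + n + 2).
Proof.
have [n1|[-> ->]] := edge_zero h; last first.
  by rewrite /ey /bP !sub0r (_ : -1 - (0 + 1) + 2 = 0) // oppr0 qs0 !(mulr0, mul0r) oppr0 mul0r.
rewrite eyE; last by lia.
congr (- (_ * Q _) / Q _); try by lia.
by rewrite (qpP hq) (qpS hq); field; rewrite gt_eqF // (p0 hq).
Qed.

Let D2 : Q (n + n + 2) * Q (n + n + 2) = 1 - (N n * N n * q) ^+ 2.
Proof. by rewrite (qsM hq) ?addr_ge0 // (qpD hq _ 2) (qp2 hq) (qpD hq) expr2. Qed.
Let D4 : Q (n + n + 4) * Q (n + n + 4) = 1 - (N n * N n * q * q) ^+ 2.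
Proof.
by rewrite (qsM hq) ?addr_ge0 // (qpD hq _ 4) (qp4 hq) (qpD hq) expr2 -(mulrA _ q q).
Qed.

Let d2 := qp_q_sq_neq1 hq n0.
Let d4 := qp_qq_sq_neq1 hq n0.
Let e2 : Q (n + n + 2) != 0. Proof. by rewrite (qs_neq0 hq) //; lia. Qed.
Let e4 : Q (n + n + 4) != 0. Proof. by rewrite (qs_neq0 hq) //; lia. Qed.
Let Nj0 : N j != 0. Proof. exact: qp_neq0. Qed.

Let sq (a b : R) : (a / b) ^+ 2 = (a * a) / (b * b).
Proof. by rewrite expr_div_n !expr2. Qed.

Lemma edge_ts00 : ex (n + 1) (j + 1) ^+ 2 + q ^+ 2 * ey n j ^+ 2 = 1.
Proof.
rewrite x1 y0 !sq D4.
transitivity ((Q (n + j + 2) * Q (n + j + 2) +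
  q ^+ 2 * (N n * N j) ^+ 2 * (Q (n - j + 2) * Q (n - j + 2))) /
  (1 - (N n * N n * q * q) ^+ 2)); first by field.
by rewrite !(qsM_basis hq h); field; rewrite d4 Nj0.
Qed.

(** The only entry that sees the missing vector: it is 0 instead of 1 at f_00. *)
Lemma edge_ts11 : eomega n * (ey (n - 1) (j + 1) ^+ 2 + ex n j ^+ 2) = (n != 0)%:R.
Proof.
have [n1|[-> ->]] := edge_zero h; last first.
  by rewrite /eomega qp0 !mul1r expr1n subrr invr0 mulr0 mul0r.
rewrite (gt_eqF n1) -[RHS]/(1 : R) x0 y1 !sq D2 /eomega.
have d0 := qp_sq_lt1 hq n1.
transitivity ((N n * N j) ^+ 2 * (Q (n - j) * Q (n - j)) / (1 - (N n * N n) ^+ 2) +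
  (Q (n + j) * Q (n + j)) / (1 - (N n * N n) ^+ 2)); first by field; rewrite d0 d2.
by rewrite !(qsM_basis hq h); field; rewrite d0 Nj0.
Qed.

Lemma edge_st00 : ex n j ^+ 2 + eomega (n + 1) * ey n j ^+ 2 = 1.
Proof.
rewrite x0 y0 !sq D2 D4 eomegaS.
transitivity (((Q (n + j) * Q (n + j)) +
  (N n * N j) ^+ 2 * (Q (n - j + 2) * Q (n - j + 2))) /
  (1 - (N n * N n * q) ^+ 2)); first by field; rewrite d4 d2.
by rewrite !(qsM_basis hq h); field; rewrite d2 Nj0.
Qed.

Lemma edge_st11 :
  q ^+ 2 * ey (n - 1) (j + 1) ^+ 2 + eomega (n + 1) * ex (n + 1) (j + 1) ^+ 2 = 1.
Proof.
rewrite x1 y1 !sq D2 D4 eomegaS.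
transitivity ((q ^+ 2 * (N n * N j) ^+ 2 * (Q (n - j) * Q (n - j)) +
  Q (n + j + 2) * Q (n + j + 2)) /
  (1 - (N n * N n * q) ^+ 2)); first by field; rewrite d4 d2.
by rewrite !(qsM_basis hq h); field; rewrite d2 Nj0.
Qed.

Lemma edge_st01 :
  - q * (ex n (j + 1 + 1) * ey (n - 1) (j + 1)) +
  ey n (j + 1 + 1) * (eomega (n + 1) * ex (n + 1) (j + 1)) = 0.
Proof.
rewrite x1 y1 eomegaS -D2 -D4 (_ : j + 1 + 1 = j + 2); last by lia.
have [n1|[-> ->]] := edge_zero h; last first.
  by rewrite /ey /bP (_ : 0 - (0 + 2) + 2 = 0) // subrr qs0 !(mulr0, mul0r, oppr0, addr0).
rewrite exE // eyE // (qpD hq j) (qp2 hq) (_ : n - (j + 2) + 2 = n - j); last by lia.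
by rewrite addrA; field; rewrite e2 e4.
Qed.

Lemma edge_st10 :
  - q * (ey (n - 1) (j - 1) * ex n j) +
  ex (n + 1) (j - 1) * (eomega (n + 1) * ey n j) = 0.
Proof.
rewrite x0 y0 eomegaS -D2 -D4 (exE _ (n := n + 1)); last by lia.
rewrite (_ : n + 1 + (j - 1) = n + j); last by ring.
rewrite (_ : n + 1 + (n + 1) + 2 = n + n + 4); last by ring.
have [n1|[-> ->]] := edge_zero h; last first.
  by rewrite addr0 qs0 !(mulr0, mul0r, oppr0, addr0).
rewrite eyE; last by lia.
rewrite (_ : n - 1 - (j - 1) + 2 = n - j + 2); last by ring.
rewrite (_ : n - 1 + (n - 1) + 4 = n + n + 2); last by ring.
rewrite !(qpP hq); move: (pp hq) (p0 hq) e2 e4; move: p => r <- r0 h2 h4.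
by field; rewrite h2 h4 gt_eqF.
Qed.

Lemma edge_ts01 : ex (n - 1) (j + 1) * ey (n - 1) (j + 1) -
  q * (ey (n - 1 - 1) (j - 1 + 1) * ex n j) = 0.
Proof.
rewrite y1 x0 subrK.
have [n1|[-> ->]] := edge_zero h; last first.
  by rewrite ?addr0 ?subrr ?add0r qs0 !(mulr0, mul0r, oppr0, addr0).
(* for n = 1 the target lies below level 0, and both terms vanish *)
have [n2|E] : 1 < n \/ n = 1 by lia.
  rewrite exE; last by lia.
  rewrite eyE; last by lia.
  rewrite (_ : n - 1 + (j + 1) = n + j); last by ring.
  rewrite (_ : n - 1 - 1 - j + 2 = n - j); last by ring.
  rewrite (_ : n - 1 - 1 + (n - 1 - 1) + 4 = n - 1 + (n - 1) + 2); last by ring.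
  have e0 : Q (n - 1 + (n - 1) + 2) != 0 by rewrite (qs_neq0 hq) //; lia.
  rewrite !(qpP hq); move: (pp hq) (p0 hq) e2 e0; move: p => r <- r0 h2 h0.
  by field; rewrite h2 h0 gt_eqF.
have [Ej|Ej] : j = 1 \/ j = -1 by apply: edge_one; rewrite -E.
all: by rewrite Ej E subrr qs0 /ex /ey /aM /bP !(mulr0, mul0r, oppr0, addr0, subrr) qs0
  !(mulr0, mul0r, oppr0, addr0, subrr).
Qed.

Lemma edge_ts10 : ey (n + 1) (j + 1) * ex (n + 1) (j + 1) -
  q * (ex (n + 1 + 1) (j - 1 + 1) * ey n j) = 0.
Proof.
rewrite x1 y0 subrK.
rewrite eyE; last by lia.
rewrite exE; last by lia.
rewrite (_ : n + 1 - (j + 1) + 2 = n - j + 2); last by ring.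
rewrite (_ : n + 1 + 1 + j = n + j + 2); last by ring.
rewrite (_ : n + 1 + 1 + (n + 1 + 1) + 2 = n + n + 6); last by ring.
rewrite (_ : n + 1 + (n + 1) + 4 = n + n + 6); last by ring.
have e6 : Q (n + n + 6) != 0 by rewrite (qs_neq0 hq) //; lia.
rewrite !(qpS hq); move: (pp hq) e4 e6; move: p => r <- h4 h6.
by field; rewrite h4 h6.
Qed.
End AtIndex.
End EdgeCoefficients.

Section Index.
Context {R : realType} {q : R} (hq : 0 < q < 1).
Context {H : completeNormedModType R[i]} {dot : {dot H for Num.conj}}.
Context (hdot : hilbert_norm dot) {e : int * int * int -> H}.
Context (he : orthonormal_basis dot basis_index e).
Context {alpha beta alphas betas P : H -> H}.
Context (aa : adjoint_pair dot alpha alphas) (bb : adjoint_pair dot beta betas).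
Context (PP : adjoint_pair dot P P).
Implicit Types (n i j k : int) (x y : H).
Local Notation "x %:C" := (real_complex R x).
Local Notation aP := (@aP R q).
Local Notation aM := (@aM R q).
Local Notation bP := (@bP R q).
Local Notation bM := (@bM R q).
Local Notation ex := (@ex R q).
Local Notation ey := (@ey R q).
Local Notation om := (@eomega R q).
Context (alphaE : forall n i j, alpha (e (n, i, j)) =
  (aP n i j)%:C *: e (n + 1, i - 1, j - 1) + (aM n i j)%:C *: e (n - 1, i - 1, j - 1)).
Context (betaE : forall n i j, beta (e (n, i, j)) =
  (bP n i j)%:C *: e (n + 1, i + 1, j - 1) + (bM n i j)%:C *: e (n - 1, i + 1, j - 1)).
Context (alphasE : forall n i j, alphas (e (n, i, j)) =
    (aM (n + 1) (i + 1) (j + 1))%:C *: e (n + 1, i + 1, j + 1) +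
    (aP (n - 1) (i + 1) (j + 1))%:C *: e (n - 1, i + 1, j + 1)).
Context (betasE : forall n i j, betas (e (n, i, j)) =
    (bM (n + 1) (i - 1) (j + 1))%:C *: e (n + 1, i - 1, j + 1) +
    (bP (n - 1) (i - 1) (j + 1))%:C *: e (n - 1, i - 1, j + 1)).
Context (PE : forall n i j, P (e (n, i, j)) = if n == i then e (n, i, j) else 0).

Let ha : bounded_op alpha. Proof. by have [] := aa. Qed.
Let hb : bounded_op beta. Proof. by have [] := bb. Qed.
Let has : bounded_op alphas. Proof. by have [] := aa. Qed.
Let hbs : bounded_op betas. Proof. by have [] := bb. Qed.
Let hP : bounded_op P. Proof. by have [] := PP. Qed.

Local Notation f n j := (e (n, n, j)).

Let PPx x : P (P x) = P x.
Proof.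
suff /(congr1 (@^~ x)) : (fun x => P (P x)) = P by [].
apply: (bounded_op_eq he) => [||[[n i] j] _] //; first exact: bounded_op_comp.
by rewrite PE; case: ifP => E; rewrite ?PE ?E ?(bounded_op0 hP).
Qed.

Let Pf n j : P (f n j) = f n j. Proof. by rewrite PE eqxx. Qed.

Let A x := P (alpha x).
Let B x := P (beta x).
Let A' x := P (alphas x).
Let B' x := P (betas x).

Let Af n j : A (f n j) = (ex n j)%:C *: f (n - 1) (j - 1).
Proof.
rewrite /A alphaE (bounded_opD hP) !(bounded_opZ hP) !PE eqxx.
by rewrite (_ : (n + 1 == n - 1) = false) ?scaler0 ?add0r //; lia.
Qed.
Let Bf n j : B (f n j) = (ey n j)%:C *: f (n + 1) (j - 1).
Proof.
rewrite /B betaE (bounded_opD hP) !(bounded_opZ hP) !PE eqxx.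
by rewrite (_ : (n - 1 == n + 1) = false) ?scaler0 ?addr0 //; lia.
Qed.
Let A'f n j : A' (f n j) = (ex (n + 1) (j + 1))%:C *: f (n + 1) (j + 1).
Proof.
rewrite /A' alphasE (bounded_opD hP) !(bounded_opZ hP) !PE eqxx.
by rewrite (_ : (n - 1 == n + 1) = false) ?scaler0 ?addr0 //; lia.
Qed.
Let B'f n j : B' (f n j) = (ey (n - 1) (j + 1))%:C *: f (n - 1) (j + 1).
Proof.
rewrite /B' betasE (bounded_opD hP) !(bounded_opZ hP) !PE eqxx.
by rewrite (_ : (n + 1 == n - 1) = false) ?scaler0 ?add0r //; lia.
Qed.

Let Ab : bounded_op A. Proof. exact: bounded_op_comp hP ha. Qed.
Let Bb : bounded_op B. Proof. exact: bounded_op_comp hP hb. Qed.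
Let A'b : bounded_op A'. Proof. exact: bounded_op_comp hP has. Qed.
Let B'b : bounded_op B'. Proof. exact: bounded_op_comp hP hbs. Qed.
Let AZ := bounded_opZ Ab.
Let BZ := bounded_opZ Bb.
Let A'Z := bounded_opZ A'b.
Let B'Z := bounded_opZ B'b.

Let exists_W : exists2 W, adjoint_pair dot W W &
  forall s, basis_index s -> W (e s) = (om s.1.1)%:C *: e s.
Proof.
have [[[n i] j] h|W [hW _ We]] := @diagonal_pair _ _ _ hdot _ _ _ he
    (fun s => om s.1.1) (@qs R q 2 * @qs R q 2)^-1.
  by apply: eomega_bound; have [] := basis_indexP h.
by exists W.
Qed.

(* Identities on the range of P are checked on the edge vectors. *)
Let on_range (F G : H -> H) : bounded_op F -> bounded_op G ->
  (forall n j, basis_index (n, n, j) -> F (f n j) = G (f n j)) ->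
  forall x, P x = x -> F x = G x.
Proof.
move=> hF hG h x <-.
suff /(congr1 (@^~ x)) : (fun x => F (P x)) = (fun x => G (P x)) by [].
apply: (bounded_op_eq he); [exact: bounded_op_comp|exact: bounded_op_comp|].
move=> [[n i] j]; rewrite PE; case: eqP => [<-|_ _]; first exact: h.
by rewrite (bounded_op0 hF) (bounded_op0 hG).
Qed.

Section Inverse.
Context (W : H -> H) (hW : adjoint_pair dot W W).
Context (We : forall s, basis_index s -> W (e s) = (om s.1.1)%:C *: e s).
Let Wb : bounded_op W. Proof. by have [] := hW. Qed.
Let WZ := bounded_opZ Wb.
Let Wf n j : W (f n j) = (om n)%:C *: f n j.
Proof.
have [/We //|/(basis_out he) ->] := boolP (basis_index (n, n, j)).
by rewrite (bounded_op0 Wb) scaler0.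
Qed.

Ltac bounded := repeat first [exact: bounded_op_id | exact: bounded_op_zero |
  exact: rank_one_bounded |
  apply: bounded_op_add | apply: bounded_op_opp | apply: bounded_op_scale |
  assumption |
  match goal with |- bounded_op (fun x => ?F (@?G x)) => apply: (@bounded_op_comp _ _ F G) end].

Ltac entries := rewrite ?(Af, Bf, A'f, B'f, Wf, AZ, BZ, A'Z, B'Z, WZ);
  rewrite ?addrK ?subrK ?scalerA -?rmorphM.

Let scal_add (m a b : R) y : a + b = m -> a%:C *: y + b%:C *: y = m%:C *: y.
Proof. by move=> <-; rewrite rmorphD scalerDl. Qed.

Let ts00 x : P x = x -> A (A' x) + (q ^+ 2)%:C *: B' (B x) = x.
Proof.
apply: (on_range (F := fun x => A (A' x) + (q ^+ 2)%:C *: B' (B x)) (G := id)).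
- bounded.
- bounded.
move=> n j h; entries.
rewrite (@scal_add 1) ?scale1r // -(edge_ts00 hq h); ring.
Qed.

Let ts01 x : P x = x -> A (B' x) = q%:C *: B' (A x).
Proof.
apply: (on_range (F := fun x => A (B' x)) (G := fun x => q%:C *: B' (A x))).
- bounded.
- bounded.
move=> n j h; entries.
congr (_%:C *: _); apply/eqP; rewrite -subr_eq0; apply/eqP.
by have := edge_ts01 hq h; rewrite subrK => <-; ring.
Qed.

Let ts10 x : P x = x -> B (A' x) = q%:C *: A' (B x).
Proof.
apply: (on_range (F := fun x => B (A' x)) (G := fun x => q%:C *: A' (B x))).
- bounded.
- bounded.
move=> n j h; entries.
congr (_%:C *: _); apply/eqP; rewrite -subr_eq0; apply/eqP.
by have := edge_ts10 hq h; rewrite subrK => <-; ring.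
Qed.

Let ts11 x : P x = x -> B (B' (W x)) + A' (A (W x)) = x - dot x (f 0 0) *: f 0 0.
Proof.
apply: (on_range (F := fun x => B (B' (W x)) + A' (A (W x)))
                 (G := fun x => x - dot x (f 0 0) *: f 0 0)).
- bounded.
- bounded.
move=> n j h; entries.
rewrite (@scal_add (n != 0)%:R); last by rewrite -(edge_ts11 hq h); ring.
rewrite (dot_basis he) h /=.
have [n0|[n0 j0]] := edge_zero h; last by rewrite n0 j0 eqxx scale0r scale1r subrr.
by rewrite !xpair_eqE (gt_eqF n0) scale1r scale0r subr0.
Qed.

Let st00 x : P x = x -> A' (A x) + B' (W (B x)) = x.
Proof.
apply: (on_range (F := fun x => A' (A x) + B' (W (B x))) (G := id)).
- bounded.
- bounded.
move=> n j h; entries.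
rewrite (@scal_add 1) ?scale1r // -(edge_st00 hq h); ring.
Qed.

Let st01 x : P x = x -> A' ((- q)%:C *: B' x) + B' (W (A' x)) = 0.
Proof.
apply: (on_range (F := fun x => A' ((- q)%:C *: B' x) + B' (W (A' x))) (G := fun=> 0)).
- bounded.
- bounded.
move=> n j h; entries.
rewrite (@scal_add 0) ?scale0r // -(edge_st01 hq h); ring.
Qed.

Let st10 x : P x = x -> (- q)%:C *: B (A x) + A (W (B x)) = 0.
Proof.
apply: (on_range (F := fun x => (- q)%:C *: B (A x) + A (W (B x))) (G := fun=> 0)).
- bounded.
- bounded.
move=> n j h; entries.
rewrite (@scal_add 0) ?scale0r // -(edge_st10 hq h); ring.
Qed.

Let st11 x : P x = x -> (- q)%:C *: B ((- q)%:C *: B' x) + A (W (A' x)) = x.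
Proof.
apply: (on_range (F := fun x => (- q)%:C *: B ((- q)%:C *: B' x) + A (W (A' x))) (G := id)).
- bounded.
- bounded.
move=> n j h; entries.
rewrite (@scal_add 1) ?scale1r // -(edge_st11 hq h); ring.
Qed.

Let U := opmx2 alpha (fun x => (- q)%:C *: betas x) beta alphas.
Let T := compression P U.
Let rangeP := @proj_range _ H P 2.
Let o1 : 'I_2 := lift ord0 ord0.

Let ord2E (i : 'I_2) : i = ord0 \/ i = o1.
Proof. by case: i => [[|[|//]] ?]; [left|right]; exact: val_inj. Qed.

Let T0 v : rangeP v -> T v ord0 = A (v ord0) + (- q)%:C *: B' (v o1).
Proof.
move=> hv; rewrite /T /compression big_ord_recl big_ord1 !mxE /= !hv.
by rewrite (bounded_opD hP) (bounded_opZ hP).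
Qed.

Let T1 v : rangeP v -> T v o1 = B (v ord0) + A' (v o1).
Proof.
move=> hv; rewrite /T /compression big_ord_recl big_ord1 !mxE /= !hv.
by rewrite (bounded_opD hP).
Qed.

Let S (v : 'I_2 -> H) (i : 'I_2) : H :=
  if i == ord0 then A' (v ord0) + B' (W (v o1)) else (- q)%:C *: B (v ord0) + A (W (v o1)).

Let PW x : P x = x -> P (W x) = W x.
Proof.
apply: (on_range (F := fun x => P (W x))); [bounded|bounded|] => n j h.
by rewrite Wf (bounded_opZ hP) Pf.
Qed.

Let rangeS v : rangeP (S v).
Proof.
move=> i; rewrite /S; case: ifP => _; rewrite (bounded_opD hP) ?(bounded_opZ hP);
  by rewrite /A /B /A' /B' !PPx.
Qed.

(* S T = 1 on the range of P, from the four entries st00, st01, st10, st11. *)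
Let kernel v : rangeP v -> T v = 0 -> v = 0.
Proof.
move=> hv Tv; have := T0 hv; have := T1 hv; rewrite Tv /= => E1 E0.
apply/funext => i; have [->|->] := ord2E i.
- rewrite -[LHS](st00 (hv _)) -[LHS]addr0 -(st01 (hv o1)) addrACA.
  rewrite -(bounded_opD A'b) -(bounded_opD B'b) -(bounded_opD Wb) -E0 -E1.
  by rewrite (bounded_op0 A'b) (bounded_op0 Wb) (bounded_op0 B'b) addr0.
- rewrite -[LHS](st11 (hv _)) -[LHS]add0r -(st10 (hv ord0)) addrACA.
  rewrite -scalerDr -(bounded_opD Bb) -(bounded_opD Ab) -(bounded_opD Wb) -E0 -E1.
  by rewrite (bounded_op0 Bb) (bounded_op0 Wb) (bounded_op0 Ab) scaler0 addr0.
Qed.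

(* T S is the projection orthogonal to (0, f_00). *)
Let T_S0 v : rangeP v -> T (S v) ord0 = v ord0.
Proof.
move=> hv; rewrite (T0 (rangeS v)) /S /=.
rewrite (bounded_opD Ab) (bounded_opD B'b) B'Z scalerDr addrACA scalerA.
rewrite -rmorphM mulrNN -expr2 ts00 // ts01; last exact: PW.
by rewrite rmorphN scaleNr subrr addr0.
Qed.

Let T_S1 v : rangeP v -> T (S v) o1 = v o1 - dot (v o1) (f 0 0) *: f 0 0.
Proof.
move=> hv; rewrite (T1 (rangeS v)) /S /=.
rewrite (bounded_opD Bb) (bounded_opD A'b) A'Z addrACA ts11 // ts10 //.
by rewrite rmorphN scaleNr subrr add0r.
Qed.

Let b (i : 'I_2) : H := if i == ord0 then 0 else f 0 0.

(* beta' and alpha lower the level of f_00, hence kill it after compression. *)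
Let range_orth v : rangeP v -> dot (T v o1) (f 0 0) = 0.
Proof.
move=> hv; rewrite (T1 hv) dotDl.
have [_ _ hPP] := PP; have [_ _ hbb] := bb; have [_ _ /adjoint_sym haa] := aa.
rewrite /B /A' !hPP Pf hbb haa -(hv ord0) -(hv o1) !hPP.
rewrite -[P (betas _)]/(B' _) -[P (alpha _)]/(A _) B'f Af.
by rewrite !(basis_out he) // !scaler0 !dot0r addr0.
Qed.

Lemma fundamental_index_W : fredholm_index T rangeP (- 1).
Proof.
exists 0%N, 1%N; split; last by [].
- exists (fun=> 0); split=> [[]//|v [hv Tv]].
  exists 0; split=> [|c _]; last by rewrite thinmx0.
  by rewrite /= big_ord0 subr0 (kernel hv Tv).
exists (fun=> b); split=> [_ i|v hv].
  by rewrite /b; case: ifP => _; rewrite ?Pf ?(bounded_op0 hP).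
exists (const_mx (dot (v o1) (f 0 0))); split=> [|c [w hw Tw]].
  rewrite /= big_ord1 mxE; exists (S v); first exact: rangeS.
  apply/funext => i; have [->|->] := ord2E i.
    by rewrite T_S0 //= !fctE /b /= scaler0 subr0.
  by rewrite T_S1.
apply/matrixP => i j; rewrite !mxE !ord1.
have := range_orth hw; rewrite Tw big_ord1.
rewrite -[(v - _) o1]/(v o1 - c 0 0 *: f 0 0) dotBl dotZl (dot_basis he) /=.
by rewrite mulr1 => /eqP; rewrite subr_eq0 => /eqP.
Qed.

End Inverse.

(** The kernel is zero by S T = 1. The class of v in the cokernel is
    <v_1, f_00>: T S v differs from v by that multiple of (0, f_00), and the
    range of T is orthogonal to (0, f_00). *)
Lemma fundamental_index : fredholm_index
  (compression P (opmx2 alpha (fun x => (- q)%:C *: betas x) beta alphas))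
  (@proj_range _ H P 2) (- 1).
Proof. by have [W hW We] := exists_W; exact: fundamental_index_W hW We. Qed.
End Index.

(** * The theorem *)

Section Generators.
Context {R : realType} {q : R} (hq : 0 < q < 1).
Context {H : completeNormedModType R[i]} {dot : {dot H for Num.conj}}.
Context (hdot : hilbert_norm dot) {e : int * int * int -> H}.
Context (he : orthonormal_basis dot basis_index e).
Context {T : H -> H} (hT : adjoint_pair dot T T).
Context (Te : forall s, basis_index s -> T (e s) = ((dirac_ev s)^-1)%:C%C *: e s).

Local Notation I := (int * int * int)%type.
Let shiftK (d : I) : cancel (fun s : I => s + d) (fun s => s - d).
Proof. by move=> s; rewrite addrK. Qed.
Let shiftNK (d : I) : cancel (fun s : I => s - d) (fun s => s + d).
Proof. by move=> s; rewrite subrK. Qed.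
Let fn (w : int -> int -> int -> R) (s : I) : R := w s.1.1 s.1.2 s.2.

Lemma alpha_regular (alpha : H -> H) : bounded_op alpha -> alpha_action q e alpha ->
  regular dot T alpha.
Proof.
move=> ha ae.
apply: (@regular_two_terms _ _ _ hdot _ _ _ he _ _ hT Te (@dirac_ev_neq0 _) alpha
    (fun s => s + (1, -1, -1)) (fun s => s - (1, -1, -1))
    (fun s => s + (-1, -1, -1)) (fun s => s - (-1, -1, -1))
    (fn (@aP R q)) (fn (@aM R q)) 1 (@comm_bound R q) ha) => //.
- move=> [[n i] j] h _; split; last exact: comm_aP.
  by have [] := coef_le1 hq h.
- move=> [[n i] j] h _; split; last exact: comm_aM.
  by have [] := coef_le1 hq h.
- by move=> [[n i] j] h; rewrite ae // /fn a_plusE // a_minusE.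
Qed.

Lemma beta_regular (beta : H -> H) : bounded_op beta -> beta_action q e beta ->
  regular dot T beta.
Proof.
move=> hb be.
apply: (@regular_two_terms _ _ _ hdot _ _ _ he _ _ hT Te (@dirac_ev_neq0 _) beta
    (fun s => s + (1, 1, -1)) (fun s => s - (1, 1, -1))
    (fun s => s + (-1, 1, -1)) (fun s => s - (-1, 1, -1))
    (fn (@bP R q)) (fn (@bM R q)) 1 (@comm_bound R q) hb) => //.
- move=> [[n i] j] h _; split; last exact: comm_bP.
  by have [] := coef_le1 hq h.
- move=> [[n i] j] h h'; split; last exact: comm_bM.
  by have [] := coef_le1 hq h.
- by move=> [[n i] j] h; rewrite be // /fn b_plusE // b_minusE.
Qed.
End Generators.

Theorem theorem4p1 (R : realType) (q : R) (hq : 0 < q < 1)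
    (H : completeNormedModType R[i]) (dot : {dot H for Num.conj})
    (hdot : hilbert_norm dot)
    (e : int * int * int -> H) (he : orthonormal_basis dot basis_index e)
    (alpha beta : H -> H)
    (halpha : bounded_op alpha) (hbeta : bounded_op beta)
    (ealpha : alpha_action q e alpha) (ebeta : beta_action q e beta) :
  odd_spectral_triple dot (star_algebra dot [set alpha; beta])
    (dirac_op dot e) /\
  chern_nontrivial dot
    (norm_closure (star_algebra dot [set alpha; beta])) (dirac_op dot e).
Proof.
split.
  have [T hT Te] := exists_dirac_inverse hdot he.
  have DT x y := dirac_inverse hdot he hT Te x y.
  split.
  - refine (@inverse_self_adjoint _ _ _ T hT (dirac_op dot e) DT _).
    exact: (dirac_dense hdot he hT Te).
  - exists 0, T; split; first exact: (dirac_inverse_compact hdot he hT Te).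
    by move=> x y; rewrite scale0r addr0 DT; split=> ->.
  - move=> a ga; apply: (regular_bounded DT).
    apply: (regular_star_algebra hT) ga => _ [] -> .
      exact: (alpha_regular hq hdot he hT Te halpha ealpha).
    exact: (beta_regular hq hdot he hT Te hbeta ebeta).
have [alphas aa alphasE] := alpha_adjoint hq hdot he halpha ealpha.
have [betas bb betasE] := beta_adjoint hq hdot he hbeta ebeta.
have [P [negP hP PE]] := exists_edge_projection hdot he.
set A := norm_closure _.
pose U := opmx2 alpha (fun x => (- q)%:C%C *: betas x) beta alphas.
have U_GL : GL A U.
  exact: (fundamental_GL hq he halpha hbeta ealpha ebeta aa bb alphasE betasE).
exists P => //; exists (K1_class A (existT _ 2 U)), 1.
split=> //; first by exists (existT _ 2 U).
exists (existT _ 2 U); first exact: K1_class_self.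
apply: (fundamental_index hq hdot he aa bb hP) => //.
  exact: (alphaE hq he halpha ealpha).
exact: (betaE hq he hbeta ebeta).
Qed.
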